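(* Let $f$ be a finite Blaschke product with $f(0)=0$ which is not a rotation, and let $\{a_n\}_{n\ge1}$ be a sequence of complex numbers tending to $0$ such that $\sum_{n}|a_n|=\infty$. Let $\varphi$ be a measure function such that $\psi(t)=\varphi(t)/t$ is decreasing (in the wide sense) on $(0,\infty)$ and $\lim_{t\to0^+}\varphi(t)/t=\infty$. Then there exist a constant $0<c=c(f)<1$ and a positive integer $Q=Q(f)$, depending only on $f$, for which the following holds. Suppose that there exist a constant $0<\beta<1$ and a (large enough) integer $N\ge2$ such that $$\frac{c\beta}{2\sqrt3}\left(1+\frac{2}{N-1}\right)^{-1}-\frac{2}{N-1}>0,\qquad \frac{c}{2\sqrt{3(NQ+1)}}\left(1+\frac{2}{N-1}\right)^{-1}-\frac{2}{N-1}>0,$$ and such that $$\lim_{k\to\infty}\sum_{n=\overline{M}_k}^{\overline{N}_k-1}|a_n|=0\qquad\text{and}\qquad \left(\sum_{n=\overline{M}_k}^{\overline{N}_k-1}|a_n|^2\right)^{1/2}\ge\beta\sum_{n=\overline{M}_k}^{\overline{N}_k-1}|a_n|,\quad k\ge1,$$ where $\{(\overline{M}_k,\overline{N}_k)\}=\{(\overline{M}_k,\overline{N}_k)\}(\varphi,f,Q,N)$ are the sequences defined in the context. Then, for any fixed $w\in\mathbb{C}$, the set $$A(w)=\left\{\xi\in\partial\mathbb{D}\colon\sum_{n=1}^\infty a_nf^n(\xi)\text{ converges and }\sum_{n=1}^\infty a_nf^n(\xi)=w\right\}$$ satisfies $\mathcal{H}^{\varphi}(A(w))>0$.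
   Context: $\mathbb{D}$ is the open unit disk, $\partial\mathbb{D}$ the unit circle, $\mathrm{m}$ normalised Lebesgue measure on $\partial\mathbb{D}$. A finite Blaschke product with $f(0)=0$ is $f(z)=\alpha z^m\prod_{n=1}^{L}\frac{z-z_n}{1-\overline{z_n}z}$ with $|\alpha|=1$, $m\ge1$, and $z_1,\dots,z_L\in\mathbb{D}$ ($L\ge 0$); it extends analytically across $\partial\mathbb{D}$. A rotation is $z\mapsto\alpha z$, $|\alpha|=1$. $f^n$ denotes the $n$-th iterate of $f$. A measure function is a function $\varphi\colon[0,\infty)\to[0,\infty)$ with $\varphi(0)=0$ which is strictly increasing and right-continuous. For $E\subseteq\partial\mathbb{D}$, $$\mathcal{H}^\varphi(E)=\lim_{\delta\to0^+}\inf\left\{\sum_{n=1}^\infty\varphi(\mathrm{m}(I_n))\colon E\subseteq\bigcup_{n=1}^\infty I_n,\ \mathrm{m}(I_n)<\delta\text{ for }n\ge1\right\},$$ over countable covers by arcs. Arcs: for $z\in\mathbb{D}$, $I(z)$ is the closed arc centered at $z/|z|$ with $\mathrm{m}(I(z))=1-|z|$ ($I(0)=\partial\mathbb{D}$). For $\lambda>0$ and a closed arc $I\subsetneq\partial\mathbb{D}$, $\lambda I$ is the concentric closed arc of length $\lambda\,\mathrm{m}(I)$ if $\lambda\,\mathrm{m}(I)\le1$, and $\lambda I=\partial\mathbb{D}$ otherwise; for $\lambda\ge1$, $\lambda\,\partial\mathbb{D}=\partial\mathbb{D}$. Constants attached to $f$: put $C_0=\min\{|f'(\xi)|\colon\xi\in\partial\mathbb{D}\}$,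 which is $>1$. The paper proves that there exist constants $0<\varepsilon_*<1$, $0<c_*<1$, $0<\eta_*<1/4$, $1<K<\infty$ and a positive integer $d_*$, depending only on $f$, with the following property: for all positive integers $M<N$, all $z\in\mathbb{D}$ with $|f^M(z)|<\varepsilon_*$ and all complex numbers $a_M,\dots,a_N$ there is a nonempty finite family $\mathcal{F}$ of pairwise disjoint closed subarcs of $d_*I(z)$ such that (1) $\mathrm{Re}\left(\sum_{n=M}^Na_nf^n(\xi)\right)\ge c_*\left(\sum_{n=M}^N|a_n|^2\right)^{1/2}$ for every $\xi\in\bigcup_{I\in\mathcal{F}}I$; (2) $\sum_{I\in\mathcal{F}}\mathrm{m}(I)\ge\frac{c_*}{2d_*}\mathrm{m}(d_*I(z))$; (3) $\eta_*\le\mathrm{m}(f^N(I))\le4\eta_*$ for each $I\in\mathcal{F}$; (4) $\mathrm{m}(I)\le KC_0^{-(N-M)}\mathrm{m}(d_*I(z))$ for each $I\in\mathcal{F}$. One such choice of constants is fixed for each $f$, and $C_*:=c_*/(2d_* )$. The sequences: let $\varphi$ be a measure function with $\psi(t)=\varphi(t)/t$ decreasing (in the wide sense) and $\lim_{t\to0^+}\psi(t)=\infty$, and let $\psi^{-1}(t)=\sup\{s>0\colon\psi(s)>t\}$ be its generalised inverse (a quotient $\psi^{-1}(u)/\psi^{-1}(v)$ is read as $1$ in the degenerate case $\psi^{-1}(v)=\infty$). For $k\ge1$ set $$\varepsilon_k=\frac14\min\left\{C_*,\frac{\psi^{-1}(C_*^{-(k+1)})}{\psi^{-1}(C_*^{-k})}\right\}.$$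 Given positive integers $Q,N$, let $G_k$ be the first positive integer with $KC_0^{-G_k}C_0^{Q}\le\varepsilon_k$, and define $\overline{M}_1=1$ and, for $k\ge1$, $$\overline{N}_k=\overline{M}_k+G_k,\qquad\overline{M}_{k+1}=\overline{N}_k+NQ.$$ *)

(* Defs.v *)
From HB Require Import structures.
From mathcomp Require Import all_boot all_order all_algebra.
From mathcomp Require Import all_classical all_reals all_analysis.
From mathcomp Require Import complex.

Set Implicit Arguments.
Unset Strict Implicit.
Unset Printing Implicit Defensive.

Import Order.TTheory GRing.Theory Num.Theory numFieldNormedType.Exports.

Local Open Scope classical_set_scope.
Local Open Scope ring_scope.

(* R[i] gets the norm topology that the library puts on every numFieldType;
   it is only found by inference on R[i] itself after these copies. *)
HB.instance Definition _ (R : realType) :=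
  PseudoPointedMetric.copy R[i] R[i]^o.
HB.instance Definition _ (R : realType) := Vector.copy R[i] R[i]^o.
HB.instance Definition _ (R : realType) := NormedModule.copy R[i] R[i]^o.

(* The modulus as an element of R: [`|z|] is an element of R[i], and
   [`|z| = (modulus z)%:C]. *)
Notation modulus := ComplexField.Normc.normc.

Section circle.
Context {R : realType}.
Implicit Types (z zeta : R[i]) (I E : set R[i]).

Definition unit_disk : set R[i] := [set z | `|z| < 1].

Definition unit_circle : set R[i] := [set z | `|z| = 1].

Definition expi2pi (t : R) : R[i] :=
  (cos (2 * pi * t) +i* sin (2 * pi * t))%C.

(* Normalised Lebesgue measure on the circle, as a real number.  On
   non-measurable sets it is the outer measure, so it is always in [0, 1]. *)
Definition circle_measure E : R :=
  fine (lebesgue_measure (`[0, 1[ `&` expi2pi @^-1` E : set R)).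

(* Open, closed, half-open and degenerate arcs, the whole circle and set0
   (so that finite covers are countable covers). *)
Definition is_arc I := exists i : interval R, I = expi2pi @` [set` i].

(* The closed arc of centre zeta and normalised length l, for `|zeta| = 1
   and 0 <= l <= 1. *)
Definition closed_arc zeta (l : R) : set R[i] :=
  [set zeta * expi2pi t | t in `[- (l / 2), l / 2]].

Definition is_closed_arc I :=
  exists zeta l, [/\ `|zeta| = 1, 0 < l, l <= 1 & I = closed_arc zeta l].

(* The arc lambda I(z), for lambda >= 1. *)
Definition dilated_arc (lambda : R) z : set R[i] :=
  if z == 0 then unit_circle
  else if lambda * (1 - modulus z) <= 1
       then closed_arc (z / `|z|) (lambda * (1 - modulus z))
       else unit_circle.

End circle.

Section hausdorff.
Context {R : realType}.

(* Only the values of phi on [0, +oo[ are constrained. *)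
Definition measure_function (phi : R -> R) :=
  [/\ phi 0 = 0,
      forall t, 0 <= t -> 0 <= phi t,
      forall s t, 0 <= s -> s < t -> phi s < phi t &
      forall t, 0 <= t -> phi x @[x --> t^'+] --> phi t].

Definition hausdorff_content (phi : R -> R) (delta : R) (E : set R[i])
    : \bar R :=
  ereal_inf [set (\sum_(0 <= n <oo) (phi (circle_measure (J n)))%:E)%E
            | J in [set J : nat -> set R[i] |
                [/\ forall n, is_arc (J n),
                    forall n, circle_measure (J n) < delta &
                    E `<=` \bigcup_n J n]]].

Definition hausdorff_measure (phi : R -> R) (E : set R[i]) : \bar R :=
  lim (hausdorff_content phi delta E @[delta --> 0^'+]).

End hausdorff.

Section blaschke.
Context {R : realType}.
Implicit Types f : R[i] -> R[i].

Definition blaschke (alpha : R[i]) (m : nat) (s : seq R[i]) (z : R[i])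
    : R[i] :=
  alpha * z ^+ m * \prod_(w <- s) ((z - w) / (1 - w^*%C * z)).

(* The formula is read on all of R[i], with value 0 at the poles, which lie
   outside the closed disk. *)
Definition is_blaschke0 f :=
  exists alpha m s, [/\ `|alpha| = 1, (0 < m)%N,
    (forall w, w \in s -> unit_disk w) & f = blaschke alpha m s].

Definition is_rotation f :=
  exists2 alpha : R[i], `|alpha| = 1 & forall z, f z = alpha * z.

(* The minimum of |f'| over the circle, which is attained for a Blaschke
   product; derive1 is the complex derivative here. *)
Definition min_deriv f : R :=
  inf [set modulus (derive1 f xi) | xi in unit_circle].

Record arc_constants := ArcConstants {
  eps_star : R;
  c_star : R;
  eta_star : R;
  K_star : R;
  d_star : nat }.

Definition is_arc_family f (B : arc_constants) (M N : nat) (z : R[i])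
    (a : nat -> R[i]) (n : nat) (I : 'I_n -> set R[i]) :=
  let d := (d_star B)%:R in
  let dI := dilated_arc d z in
  [/\ [/\ (0 < n)%N, trivIset setT I &
          forall j, is_closed_arc (I j) /\ I j `<=` dI],
      forall j xi, I j xi ->
        c_star B * Num.sqrt (\sum_(M <= k < N.+1) modulus (a k) ^+ 2)
          <= complex.Re (\sum_(M <= k < N.+1) a k * iter k f xi),
      c_star B / (2 * d) * circle_measure dI
        <= \sum_(j < n) circle_measure (I j),
      forall j, eta_star B <= circle_measure (iter N f @` I j)
                /\ circle_measure (iter N f @` I j) <= 4 * eta_star B &
      forall j, circle_measure (I j)
        <= K_star B * min_deriv f ^- (N - M) * circle_measure dI].

(* B is an admissible choice of the constants attached to f. *)
Definition admissible f (B : arc_constants) :=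
  [/\ 0 < eps_star B < 1, 0 < c_star B < 1, 0 < eta_star B < 4^-1,
      1 < K_star B & (0 < d_star B)%N] /\
  forall M N : nat, (0 < M)%N -> (M < N)%N ->
  forall z, unit_disk z -> modulus (iter M f z) < eps_star B ->
  forall a : nat -> R[i],
  exists n (I : 'I_n -> set R[i]), is_arc_family f B M N z a I.

End blaschke.

Section sequences.
Context {R : realType}.
Variables (phi : R -> R) (f : R[i] -> R[i]) (B : @arc_constants R) (Q N : nat).

Definition psi (t : R) : R := phi t / t.

Definition psi_inv (t : R) : \bar R :=
  ereal_sup [set s%:E | s in [set s : R | 0 < s /\ t < psi s]].

(* psi_inv v = +oo when psi stays above v; the quotient is then 1. *)
Definition psi_inv_ratio (u v : R) : R :=
  if psi_inv v == +oo%E then 1 else fine (psi_inv u) / fine (psi_inv v).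

Definition C_star : R := c_star B / (2 * (d_star B)%:R).

Definition eps_seq (k : nat) : R :=
  4^-1 * Num.min C_star (psi_inv_ratio (C_star ^- k.+1) (C_star ^- k)).

(* The first positive integer in P; 0 if there is none. *)
Definition first_pos (P : set nat) : nat :=
  xget 0%N [set g | [/\ (0 < g)%N, P g &
                        forall h, (0 < h)%N -> P h -> (g <= h)%N]].

Definition gap_seq (k : nat) : nat :=
  first_pos [set g | K_star B * min_deriv f ^- g * min_deriv f ^+ Q
                     <= eps_seq k].

(* Indexed from 1; the value at 0 is not used. *)
Fixpoint M_bar (k : nat) : nat :=
  match k with
  | 0 | 1 => 1
  | k'.+1 => M_bar k' + gap_seq k' + N * Q
  end%N.

Definition N_bar (k : nat) : nat := (M_bar k + gap_seq k)%N.

End sequences.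

(* The values of a at 0 are not used: the series starts at n = 1. *)
Definition sum_level_set {R : realType} (f : R[i] -> R[i]) (a : nat -> R[i])
    (w : R[i]) : set R[i] :=
  [set xi | unit_circle xi /\
     \sum_(1 <= n < k) a n * iter n f xi @[k --> \oo] --> w].

(* Main.v *)
(** A single nested sequence of arcs is enough.  If the Hausdorff content of the
    level set were small, it would be covered by arcs [J_n] with small
    [sum phi (m J_n)].  Give each [J_n] a scale [k_n] with
    [psi_inv (C^-(k_n+1)) <= m J_n < psi_inv (C^-k_n)], enlarge it to an arc [E_n]
    of comparable length, and let [nu] be the measure of density
    [sum C^-k_n 1_(E_n)], of total mass less than 1.  The arcs of generation [k+1]
    inside an arc [D] of generation [k] fill a proportion [C = C_star] of [D], so
    [nu D < C^-k m(D)] passes to one of them, and one can descend forever.  An arc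
    of generation [k_n] met by [J_n] is so short that it lies in [E_n], which the
    inequality forbids: the limit point lies in no [J_n].

    On the way down, the block of coefficients of each generation is turned by a
    unimodular factor so that it pushes the partial sum towards [w]; property (1)
    gives a drift proportional to the sum of [|a_n|] over the block.  The [Q]
    terms skipped between two blocks are placed, among [N] windows of length [Q],
    where they cost the least.

    The next generation starts at a point [z] with [|f^(n+Q)(z)| < eps_star]
    because [f] expands arcs with bounded distortion, and Julia's lemma applied
    to [f^n] at two boundary points with distant images keeps [f^n(z)] away from
    the circle. *)

Require Import Defs.
From HB Require Import structures.
From mathcomp Require Import all_boot all_order all_algebra.
From mathcomp Require Import all_classical all_reals all_analysis.
From mathcomp Require Import complex.
From mathcomp Require Import ring lra zify.
Import Order.TTheory GRing.Theory Num.Theory numFieldNormedType.Exports.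
Local Open Scope classical_set_scope.
Local Open Scope ring_scope.
Set Implicit Arguments.
Unset Strict Implicit.
Unset Printing Implicit Defensive.

(** * The modulus and the parametrisation of the circle *)

(** The direction in which a block is turned has to be fixed before the limit point is known. It is
    therefore read off at one reference point of the current arc; since the iterates expand, the
    resulting error is a geometrically weighted average of the [|a_n|], which tends to 0 with [a_n].
    The blocks actually used contain those between [M_bar] and [N_bar], so they are still long
    enough for the decay prescribed by [eps_seq]. Their two extra ends have at most [N Q + 1] terms
    each, and there Cauchy-Schwarz replaces the hypothesis on [beta]; this is the source of
    [3 (N Q + 1)], the 3 counting the three pieces. The drift per block is [gam / 2] times its sum
    of [|a_n|], with [gam] equal to [c_star] times [mu_rate] over [sqrt 3]. The skipped terms cost
    at most [1 / (N - 1)] times the sums of the two adjacent blocks, so each block is charged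
    [2 / (N - 1)]; the two numerical conditions ensure that the drift wins. The sequence [eps_seq]
    is made so that the lengths of the arcs telescope against [psi_inv (C^-k)]; this bounds an arc
    of generation [k_n] by a constant times the length at which [k_n] was chosen. *)

Section modulus_lemmas.
Context {R : realType}.
Implicit Types (z w : R[i]) (x y : R).

Lemma normcE_modulus z : `|z| = (modulus z)%:C%C.
Proof. by []. Qed.

Lemma modulus_ge0 z : 0 <= modulus z.
Proof. by case: z => a b; rewrite /= sqrtr_ge0. Qed.

Lemma modulusM z w : modulus (z * w) = modulus z * modulus w.
Proof. exact: ComplexField.Normc.normcM. Qed.

Lemma modulusV z : modulus z^-1 = (modulus z)^-1.
Proof. exact: ComplexField.Normc.normcV. Qed.

Lemma modulusN z : modulus (- z) = modulus z.
Proof. exact: (@normcN R). Qed.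

Lemma modulusD z w : modulus (z + w) <= modulus z + modulus w.
Proof. exact: (@le_normcD R). Qed.

Lemma modulusB z w : modulus (z - w) = modulus (w - z).
Proof. by rewrite -modulusN opprB. Qed.

Lemma modulus_sub_le z w : modulus (z - w) <= modulus z + modulus w.
Proof. by rewrite -(modulusN w) modulusD. Qed.

Lemma modulus_le_add z w : modulus z <= modulus (z - w) + modulus w.
Proof. by rewrite -{1}(subrK w z) modulusD. Qed.

Lemma modulus_sqr z : modulus z ^+ 2 = complex.Re z ^+ 2 + complex.Im z ^+ 2.
Proof. by case: z => a b /=; rewrite sqr_sqrtr// addr_ge0// sqr_ge0. Qed.

Lemma modulusX z n : modulus (z ^+ n) = modulus z ^+ n.
Proof.
elim: n => [|n IH]; first by rewrite !expr0 ComplexField.Normc.normc1.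
by rewrite !exprS modulusM IH.
Qed.

Lemma modulusJ z : modulus (z^*)%C = modulus z.
Proof. by case: z => a b /=; rewrite sqrrN. Qed.

Lemma modulus_real x : 0 <= x -> modulus (x%:C)%C = x.
Proof. by move=> x0; rewrite /= expr0n /= addr0 sqrtr_sqr ger0_norm. Qed.

Lemma modulus_eq1 z : (`|z| = 1) <-> (modulus z = 1).
Proof.
split => [|h]; last by rewrite normcE_modulus h.
by rewrite normcE_modulus => -[].
Qed.

Lemma modulus_lt1 z : (`|z| < 1) = (modulus z < 1).
Proof. by rewrite normcE_modulus -[1]/((1:R)%:C%C) ltcR. Qed.

Lemma modulus_Re z : complex.Re z <= modulus z.
Proof.
apply: le_trans (ler_norm _) _; rewrite -(ler_pXn2r (n:=2))// ?nnegrE ?modulus_ge0//.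
by rewrite real_normK ?num_real// modulus_sqr lerDl sqr_ge0.
Qed.

Lemma modulus_eq0 z : modulus z = 0 -> z = 0.
Proof. exact: ComplexField.Normc.eq0_normc. Qed.

Lemma modulus0 : modulus (0 : R[i]) = 0.
Proof. exact: ComplexField.Normc.normc0. Qed.

Lemma modulus1 : modulus (1 : R[i]) = 1.
Proof. exact: ComplexField.Normc.normc1. Qed.

Lemma modulus_gt0 z : z != 0 -> 0 < modulus z.
Proof.
move=> z0; rewrite lt_neqAle modulus_ge0 andbT eq_sym.
by apply: contra_neq z0 => /modulus_eq0.
Qed.

Lemma modulus1_neq0 z : modulus z = 1 -> z != 0.
Proof. by apply: contra_eq_neq => ->; rewrite modulus0 eq_sym oner_neq0. Qed.

Lemma modulus_sum (I : Type) (r : seq I) (P : pred I) (F : I -> R[i]) :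
  modulus (\sum_(i <- r | P i) F i) <= \sum_(i <- r | P i) modulus (F i).
Proof.
elim/big_ind2: _ => //; first by rewrite modulus0.
by move=> a b c d ab cd; apply: le_trans (modulusD _ _) (lerD _ _).
Qed.

End modulus_lemmas.

Section expi2pi_lemmas.
Context {R : realType}.
Implicit Types (s t : R).
Local Notation e := (@expi2pi R).

Lemma expi2piD s t : e (s + t) = e s * e t.
Proof.
by rewrite /expi2pi mulrDr cosD sinD; apply/eqP; rewrite eq_complex /=;
  apply/andP; split; apply/eqP; ring.
Qed.

Lemma expi2pi0 : e 0 = 1.
Proof. by rewrite /expi2pi mulr0 cos0 sin0. Qed.

Lemma modulus_expi2pi t : modulus (e t) = 1.
Proof. by rewrite /= cos2Dsin2 sqrtr1. Qed.

Lemma expi2pi_neq0 t : e t != 0.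
Proof. exact/modulus1_neq0/modulus_expi2pi. Qed.

Lemma expi2piN t : e (- t) = (e t)^-1.
Proof.
by apply: (mulIf (expi2pi_neq0 t)); rewrite -expi2piD addNr expi2pi0 mulVf// expi2pi_neq0.
Qed.

Lemma expi2pi1 : e 1 = 1.
Proof. by rewrite /expi2pi mulr1 mulr_natl cos2pi sin2pi. Qed.

Lemma expi2pi_int (k : int) : e k%:~R = 1.
Proof.
have H (n : nat) : e n%:R = 1.
  elim: n => [|n IH]; first by rewrite expi2pi0.
  by rewrite -natr1 expi2piD IH expi2pi1 mul1r.
case: k => n; first exact: H.
by rewrite NegzE mulrNz expi2piN H invr1.
Qed.

Lemma expi2piDz t (k : int) : e (t + k%:~R) = e t.
Proof. by rewrite expi2piD expi2pi_int mulr1. Qed.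

(** Subtracting the floor reduces to [0, 1). There the double angle formula turns cos (2 pi s) = 1
    into sin (pi s) = 0, and the sine has no zero strictly between 0 and pi. *)
Lemma expi2pi_eq1 t : e t = 1 -> exists k : int, t = k%:~R.
Proof.
move=> h; exists (Num.floor t).
suff H : forall s, 0 <= s < 1 -> e s = 1 -> s = 0.
  apply/eqP; rewrite -subr_eq0; apply/eqP; apply: H.
    have := floor_itv t; rewrite intrD => /andP[h1 h2].
    by apply/andP; split; lra.
  by rewrite -mulrNz expi2piDz.
move=> s /andP[s0 s1] es.
have sp : sin (pi * s) = 0.
  have := congr1 (@complex.Re R) es; rewrite /= -mulrA mulr_natl mulr2n cosD -!expr2.
  rewrite cos2sin2 => h2; apply/eqP; rewrite -[_ == 0](sqrf_eq0 (sin (pi * s))).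
  by apply/eqP; lra.
apply/eqP; apply: contra_eqT sp => sn0; rewrite gt_eqF// sin_gt0_pi//.
have s_gt0 : 0 < s by rewrite lt_neqAle eq_sym sn0.
by rewrite mulr_gt0 ?pi_gt0//= -[ltRHS]mulr1 ltr_pM2l ?pi_gt0.
Qed.

Lemma expi2pi_eq s t : e s = e t -> exists k : int, s = t + k%:~R.
Proof.
move=> h; have [k hk] : exists k : int, s - t = k%:~R.
  by apply: expi2pi_eq1; rewrite expi2piD expi2piN h divff// expi2pi_neq0.
by exists k; rewrite -hk addrC subrK.
Qed.

Lemma expi2pi_surj (z : R[i]) : modulus z = 1 -> exists t, z = e t.
Proof.
case: z => x y h.
have h2 : x ^+ 2 + y ^+ 2 = 1 by have := modulus_sqr (x +i* y)%C; rewrite h expr1n /= => <-.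
have xI : -1 <= x <= 1 by apply/andP; split; nra.
have pi2 : (2 * pi : R) != 0 by rewrite mulf_neq0 ?pnatr_eq0// gt_eqF ?pi_gt0.
have [y0|y0] := leP 0 y.
  exists (acos x / (2 * pi)); rewrite /expi2pi mulrC divfK// acosK ?in_itv// sin_acos ?in_itv//.
  by rewrite -h2 addrAC subrr add0r sqrtr_sqr ger0_norm.
exists (- acos x / (2 * pi));
  rewrite /expi2pi mulrC divfK// cosN sinN acosK ?in_itv// sin_acos ?in_itv//.
by rewrite -h2 addrAC subrr add0r sqrtr_sqr ltr0_norm// opprK.
Qed.



Lemma is_derive_mul2pi t : is_derive t 1 (fun s : R => 2 * pi * s) (2 * pi).
Proof.
have := @is_deriveZ _ _ _ (id : R -> R) (2 * pi) t 1 1 (is_derive_id _ _).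
by rewrite /GRing.scale/= mulr1.
Qed.

Lemma is_derive_cos2pi t :
  is_derive t 1 (fun s : R => cos (2 * pi * s)) (- sin (2 * pi * t) * (2 * pi)).
Proof. exact: (is_derive1_comp (is_derive_cos _) (is_derive_mul2pi t)). Qed.

Lemma is_derive_sin2pi t :
  is_derive t 1 (fun s : R => sin (2 * pi * s)) (cos (2 * pi * t) * (2 * pi)).
Proof. exact: (is_derive1_comp (is_derive_sin _) (is_derive_mul2pi t)). Qed.

Lemma is_derive_lipschitz (g dg : R -> R) (K : R) :
  (forall x : R, is_derive x 1 g (dg x)) -> (forall x : R, `|dg x| <= K) ->
  forall s t, `|g s - g t| <= K * `|s - t|.
Proof.
move=> gd dK s t; wlog st : s t / s < t.
  move=> H; have [st|ts|->] := ltgtP s t; first exact: H.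
    by rewrite distrC (distrC s); exact: H.
  by rewrite !subrr normr0 mulr0.
have [|c _ hc] := @MVT R g dg s t st (fun x _ => gd x).
  apply: derivable_within_continuous => x _.
  by have := gd x; case.
by rewrite distrC hc normrM (distrC t) ler_wpM2r.
Qed.

Lemma pi_le4 : (pi : R) <= 4.
Proof. by have [/andP[_ h] _] := pihalf_02_cos_pihalf R; lra. Qed.

Lemma modulus_le_ReIm (z : R[i]) : modulus z <= `|complex.Re z| + `|complex.Im z|.
Proof.
rewrite -(ler_pXn2r (n:=2))// ?nnegrE ?modulus_ge0 ?addr_ge0//.
rewrite modulus_sqr -(real_normK (num_real (complex.Re z))) -(real_normK (num_real (complex.Im z))).
have := normr_ge0 (complex.Re z); have := normr_ge0 (complex.Im z).
by set u := `|_|; set v := `|_|; nra.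
Qed.

(** The constant is crude: each of the two coordinates is 8-Lipschitz because [2 * pi <= 8]. *)
Lemma expi2pi_lipschitz s t : modulus (e s - e t) <= 16 * `|s - t|.
Proof.
apply: le_trans (modulus_le_ReIm _) _ => /=.
have p8 : `|2 * pi : R| <= 8.
  by rewrite ger0_norm ?mulr_ge0 ?pi_ge0//; have := pi_le4; lra.
have H1 := is_derive_lipschitz (K := 8) is_derive_cos2pi _ s t.
have H2 := is_derive_lipschitz (K := 8) is_derive_sin2pi _ s t.
have -> : 16 * `|s - t| = 8 * `|s - t| + 8 * `|s - t| by ring.
apply: lerD.
- apply: H1 => x; rewrite normrM -[leRHS]mul1r ler_pM// normrN; exact: sin_max.
- apply: H2 => x; rewrite normrM -[leRHS]mul1r ler_pM//; exact: cos_max.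
Qed.

End expi2pi_lemmas.

Section complex_topology.
Context {R : realType}.

Lemma cvg_modulusP {T : Type} {F : set_system T} {FF : Filter F} (f : T -> R[i]) (l : R[i]) :
  f x @[x --> F] --> l <-> forall eps : R, 0 < eps -> \forall x \near F, modulus (f x - l) < eps.
Proof.
split.
  move=> /cvgrPdist_lt H eps e0; have := H (eps%:C)%C.
  rewrite -[0]/((0:R)%:C)%C ltcR => /(_ e0).
  by apply: filterS => x; rewrite normcE_modulus ltcR modulusB.
move=> H; apply/cvgrPdist_lt => -[a b].
rewrite ltcE /= => /andP[/eqP -> a0].
by have := H a a0; apply: filterS => x; rewrite normcE_modulus ltcR modulusB.
Qed.

Lemma cvg_modulus0 {T : Type} {F : set_system T} {FF : Filter F} (f : T -> R[i]) (l : R[i]) :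
  f x @[x --> F] --> l <-> modulus (f x - l) @[x --> F] --> (0 : R).
Proof.
rewrite cvg_modulusP; split.
  move=> H; apply/cvgrPdist_lt => eps e0; have := H _ e0.
  by apply: filterS => x; rewrite sub0r normrN ger0_norm ?modulus_ge0.
move=> /cvgrPdist_lt H eps e0; have := H _ e0.
by apply: filterS => x; rewrite sub0r normrN ger0_norm ?modulus_ge0.
Qed.

Lemma expi2pi_continuous : continuous (@expi2pi R : R -> R[i]).
Proof.
move=> t; apply/cvg_modulusP => eps e0.
have e16 : 0 < eps / 17 by rewrite divr_gt0.
near=> s; apply: le_lt_trans (expi2pi_lipschitz _ _) _.
have : `|s - t| < eps / 17 by near: s; exists (eps/17) => // y; rewrite /= distrC.
lra.
Unshelve. all: by end_near. Qed.

End complex_topology.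

(** * Measure of arcs *)

Section circle_measure_lemmas.
Context {R : realType}.
Implicit Types (s t x y : R) (A : set R[i]).
Local Notation e := (@expi2pi R).

(** The extended-real value before [fine]: additivity and countable sums are handled in this
    form. *)
Definition circle_mu A : \bar R := lebesgue_measure (`[0, 1[ `&` e @^-1` A : set R).

Definition arc x y : set R[i] := e @` `[x, y].

Lemma circle_measureE A : circle_measure A = fine (circle_mu A).
Proof. by []. Qed.

(** No measurability is asked, because [lebesgue_measure] is given on every set by the outer
    measure. *)
Lemma le_lebesgue_measure (A B : set R) : A `<=` B ->
  (lebesgue_measure A <= lebesgue_measure B)%E.
Proof.
move=> AB; rewrite /lebesgue_measure/= /lebesgue_stieltjes_measure/= /measure_extension/=.
exact: le_mu_ext.
Qed.

Lemma le_circle_mu A B : A `<=` B -> (circle_mu A <= circle_mu B)%E.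
Proof. by move=> AB; apply: le_lebesgue_measure => t [t0 /AB]. Qed.

Lemma circle_mu_le1 A : (circle_mu A <= 1)%E.
Proof.
apply: (@le_trans _ _ (lebesgue_measure (`[0, 1[ : set R))).
  by apply: le_lebesgue_measure; apply: subIsetl.
by rewrite lebesgue_measure_itv/= lte_fin ltr01 sube0.
Qed.

Lemma circle_mu_ge0 A : (0 <= circle_mu A)%E.
Proof. exact: measure_ge0. Qed.

Lemma circle_mu_fin A : circle_mu A \is a fin_num.
Proof.
by rewrite ge0_fin_numE ?circle_mu_ge0// (le_lt_trans (circle_mu_le1 A))// ltry.
Qed.

Lemma circle_muE A : circle_mu A = (circle_measure A)%:E.
Proof. by rewrite circle_measureE fineK// circle_mu_fin. Qed.

Lemma circle_measure_ge0 A : 0 <= circle_measure A.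
Proof. by rewrite -lee_fin -circle_muE circle_mu_ge0. Qed.

Lemma circle_measure_le1 A : circle_measure A <= 1.
Proof. by rewrite -lee_fin -circle_muE circle_mu_le1. Qed.

Lemma le_circle_measure A B : A `<=` B -> circle_measure A <= circle_measure B.
Proof. by move=> AB; rewrite -lee_fin -!circle_muE le_circle_mu. Qed.

Lemma arc_shift x y (k : int) : arc (x + k%:~R) (y + k%:~R) = arc x y.
Proof.
apply/seteqP; split => _ [t /= + <-]; rewrite !in_itv/= => /andP[t1 t2].
  exists (t - k%:~R); rewrite /= ?in_itv/= -?mulrNz ?expi2piDz//.
  by rewrite mulrNz lerBrDr t1 lerBlDr.
exists (t + k%:~R); rewrite /= ?in_itv/= ?expi2piDz//.
by rewrite !lerD2r t1.
Qed.

(** A point [s] of [0, 1) lies over the arc when [s] or [s + 1] is in [[x, y]]; the second disjunct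
    is the part of the arc that wraps past 1. *)
Lemma preimage_arc x y s : 0 <= x -> x < 1 -> y <= x + 1 -> 0 <= s -> s < 1 ->
  (arc x y (e s) <-> (x <= s <= y) \/ (s <= y - 1)).
Proof.
move=> x0 x1 yx s0 s1; split.
  move=> [r /=]; rewrite in_itv/= => /andP[xr ry] /esym /expi2pi_eq [k hk].
  have k1 : (k < 1)%R by rewrite -(ltr_int R); lra.
  have k2 : (-2 < k)%R by rewrite -(ltr_int R) mulrNz; lra.
  have [k0|k0] : k = 0 \/ k = -1 by lia.
    by left; move: hk; rewrite k0 addr0 => ->; rewrite xr.
  by right; move: hk; rewrite k0 mulrNz => ->; lra.
move=> [/andP[xs sy]|sy]; first by exists s => //=; rewrite in_itv/= xs.
exists (s + 1); last by rewrite (expi2piDz s 1).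
by rewrite /= in_itv/=; apply/andP; split; lra.
Qed.

Lemma circle_mu_arc x y : x <= y -> y <= x + 1 -> circle_mu (arc x y) = (y - x)%:E.
Proof.
wlog /andP[x0 x1] : x y / 0 <= x < 1.
  move=> H xy yx.
  have := floor_itv x; rewrite intrD => /andP[h1 h2].
  rewrite -(arc_shift x y (- Num.floor x)) H ?mulrNz; first by congr (_%:E); ring.
  - by apply/andP; split; lra.
  - lra.
  - lra.
move=> xy yx1; rewrite /circle_mu.
have key s : 0 <= s -> s < 1 -> (arc x y (e s) <-> (x <= s <= y) \/ (s <= y - 1)).
  by move=> s0 s1; exact: preimage_arc.
have [y1|y1] := ltP y 1.
  have -> : `[0, 1[ `&` e @^-1` arc x y = `[x, y]%classic.
    apply/seteqP; split => s /=; rewrite !in_itv/=.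
      by move=> [/andP[s0 s1]] /(key _ s0 s1)[|]//; lra.
    move=> /andP[xs sy]; split; first by apply/andP; split; lra.
    by apply/key; [lra|lra|left; rewrite xs].
  rewrite lebesgue_measure_itv/= lte_fin; case: ltP => // yx.
  by congr (_%:E); lra.
(* The length 1 is treated apart: the two pieces used below would then share the point [x]. *)
have [y1x|y1x] := ltP (y - 1) x; last first.
  have yE : y = x + 1 by lra.
  have -> : `[0, 1[ `&` e @^-1` arc x y = `[0, 1[%classic.
    apply/seteqP; split => s /=; rewrite !in_itv/=; first by case.
    move=> /andP[s0 s1]; split; first by rewrite s0.
    by apply/key => //; have [sx|sx] := leP x s; [left; lra|right; lra].
  by rewrite lebesgue_measure_itv/= lte_fin ltr01 -EFinD; congr (_%:E); lra.
have -> : `[0, 1[ `&` e @^-1` arc x y = `[x, 1[%classic `|` `[0, y - 1]%classic.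
  apply/seteqP; split => s /=; rewrite !in_itv/=.
    move=> [/andP[s0 s1]] /(key _ s0 s1)[|] h; first by left; lra.
    by right; rewrite s0.
  move=> [/andP[s1 s2]|/andP[s1 s2]]; split; try lra.
    by apply/key; [lra|lra|left; lra].
  by apply/key; [lra|lra|right].
rewrite measureU//; last first.
  apply/seteqP; split => s //=; rewrite !in_itv/=.
  by move=> [/andP[h1 h2] /andP[h3 h4]]; lra.
transitivity (lebesgue_measure (`[x, 1%R[ : set R) + lebesgue_measure (`[0%R,
  (y - 1)%R] : set R))%E.
  by [].
rewrite !lebesgue_measure_itv/= !lte_fin x1 -!EFinD; case: ltP => h.
  by rewrite -EFinD; congr (_%:E); lra.
by rewrite adde0; congr (_%:E); lra.
Qed.

Lemma circle_measure_arc x y : x <= y -> y <= x + 1 -> circle_measure (arc x y) = y - x.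
Proof. by move=> xy yx; rewrite circle_measureE circle_mu_arc. Qed.

Lemma arc_full x y : x + 1 <= y -> arc x y = @unit_circle R.
Proof.
move=> xy; apply/seteqP; split => z.
  by move=> [t _ <-]; rewrite /unit_circle/= modulus_eq1 modulus_expi2pi.
rewrite /unit_circle/= modulus_eq1 => /expi2pi_surj [t ->].
have := floor_itv (t - x); rewrite intrD => /andP[h1 h2].
exists (t + (- Num.floor (t - x))%:~R); last by rewrite expi2piDz.
by rewrite /= in_itv/= mulrNz; apply/andP; split; lra.
Qed.

Lemma circle_measure_arc_full x y : x + 1 <= y -> circle_measure (arc x y) = 1.
Proof.
move=> xy; rewrite (arc_full xy) -(@arc_full x (x + 1))// circle_measure_arc//; lra.
Qed.

Lemma circle_measure_arc_le x y : x <= y -> circle_measure (arc x y) <= y - x.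
Proof.
move=> xy; have [h|h] := leP y (x + 1); first by rewrite circle_measure_arc.
by rewrite circle_measure_arc_full; lra.
Qed.

Lemma circle_measure_unit_circle : circle_measure (@unit_circle R) = 1.
Proof. by rewrite -(@arc_full 0 1) ?circle_measure_arc ?subr0 ?add0r. Qed.

Lemma closed_arc_expi2pi s l : closed_arc (e s) l = arc (s - l / 2) (s + l / 2).
Proof.
apply/seteqP; split => _ [t /= + <-]; rewrite in_itv/= => /andP[t1 t2].
  by exists (s + t); rewrite ?expi2piD//= in_itv/=; lra.
by exists (t - s); rewrite -?expi2piD 1?addrC ?subrK//= in_itv/=; lra.
Qed.

Lemma arc_measurable x y : measurable (`[0, 1[ `&` e @^-1` arc x y : set R).
Proof.
apply: measurableI => //; apply: measurable_realfun.closed_measurable.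
apply: closed_comp; first by move=> t _; exact: expi2pi_continuous.
apply: compact_closed; first exact: norm_hausdorff.
apply: continuous_compact; last exact: segment_compact.
by apply: continuous_subspaceT => t; exact: expi2pi_continuous.
Qed.

Lemma arc_compact x y : compact (arc x y).
Proof.
apply: continuous_compact; last exact: segment_compact.
by apply: continuous_subspaceT => t; exact: expi2pi_continuous.
Qed.

(** The interval behind an arc could be unbounded or wrap several times. A measure below 1 excludes
    both: two parameters further apart than the measure would already span too large a closed arc.
    The infimum and the supremum are therefore finite and serve as endpoints. *)
Lemma is_arc_cover A d : is_arc A -> circle_measure A < d -> d <= 1 ->
  exists x y, [/\ x <= y, y - x < d & A `<=` arc x y].
Proof.
move=> [i ->] Ad d1; set m := circle_measure _ in Ad.
have m0 : 0 <= m by exact: circle_measure_ge0.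
have h x y : x \in i -> y \in i -> x <= y -> y - x <= m.
  move=> xi yi xy.
  have sub : arc x y `<=` e @` [set` i].
    move=> _ [t /= + <-]; rewrite in_itv/= => ht; exists t => //=.
    exact: (interval_is_interval xi yi).
  have := le_circle_measure sub; rewrite -/m.
  have [hx|hx] := leP y (x + 1); first by rewrite circle_measure_arc.
  by rewrite circle_measure_arc_full; lra.
have [[x0 x0i]|ni] := pselect (exists x, x \in i); last first.
  exists 0, 0; split; [lra|lra|].
  by move=> z [t ti _]; case: ni; exists t.
have hA : has_inf [set` i].
  split; first by exists x0.
  exists (x0 - m) => y /= yi; have [xy|xy] := leP x0 y; first lra.
  by have := h _ _ yi x0i (ltW xy); lra.
have hS : has_sup [set` i].
  split; first by exists x0.
  exists (x0 + m) => y /= yi; have [xy|xy] := leP y x0; first lra.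
  by have := h _ _ x0i yi (ltW xy); lra.
have a1 y : y \in i -> inf [set` i] <= y by move=> yi; apply: ge_inf => //; case: hA.
have a2 y : y \in i -> y <= sup [set` i] by move=> yi; apply: ub_le_sup => //; case: hS.
exists (inf [set` i]), (sup [set` i]); split.
- exact: le_trans (a1 _ x0i) (a2 _ x0i).
- apply: le_lt_trans Ad; rewrite lerBlDr; apply: ge_sup; first by exists x0.
  move=> y /= yi; rewrite addrC -lerBlDr; apply: lb_le_inf; first by exists x0.
  move=> x /= xi; have [xy|xy] := leP x y; last lra.
  by have := h _ _ xi yi xy; lra.
- by move=> _ [t /= ti <-]; exists t => //=; rewrite in_itv/= a1// a2.
Qed.

End circle_measure_lemmas.

(** * Boundary behaviour of Blaschke products *)

Section blaschke_like.
Context {R : realType}.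
Implicit Types (s t x y : R) (z w xi : R[i]).
Local Notation e := (@expi2pi R).
Local Notation "z ^*" := (conjc z) : ring_scope.

Lemma is_derive_ext (f g : R -> R) (t a b : R) : is_derive t 1 f a -> f =1 g -> a = b ->
  is_derive t 1 g b.
Proof. by move=> h /funext <- <-. Qed.

Lemma is_derive_mull (c : R) (f : R -> R) (t a : R) : is_derive t 1 f a ->
  is_derive t 1 (fun s => c * f s) (c * a).
Proof. by move=> h; exact: is_deriveZ. Qed.

Lemma conjcB z w : (z - w)^* = z^* - w^*.
Proof. exact: rmorphB. Qed.

Lemma conjcM z w : (z * w)^* = z^* * w^*.
Proof. exact: rmorphM. Qed.

(* [b] is the modulus of the derivative on the circle.  Everything below passes
   from two factors to their product, with [b] additive; [inner_julia] is Julia's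
   lemma cleared of denominators. *)
Record inner_like (g : R[i] -> R[i]) (b : R[i] -> R) : Prop := InnerLike {
  inner_circle : forall xi, modulus xi = 1 -> modulus (g xi) = 1;
  inner_disk : forall z, modulus z < 1 -> modulus (g z) <= 1;
  inner_ge0 : forall xi, modulus xi = 1 -> 0 <= b xi;
  inner_lipschitz : exists2 K, 0 <= K & forall xi zeta, modulus xi = 1 -> modulus zeta = 1 ->
    `|b xi - b zeta| <= K * modulus (xi - zeta);
  inner_julia : forall xi z, modulus xi = 1 -> modulus z < 1 ->
    modulus (g xi - g z) ^+ 2 * (1 - modulus z ^+ 2)
      <= b xi * modulus (xi - z) ^+ 2 * (1 - modulus (g z) ^+ 2);
  inner_lift : exists F : R -> R, forall t, g (e t) = e (F t) /\ is_derive t 1 F (b (e t));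
  inner_derive : forall xi, modulus xi = 1 ->
    is_derive xi 1 g ((b xi)%:C%C * g xi / xi) }.

(** Julia's inequality for a product, where [x], [y] are the distances between boundary and interior
    values of the factors and [r], [q] the interior moduli. The identity
    [1 - (r q)^2 = (1 - r^2) + r^2 (1 - q^2)] splits the right side into multiples of [P] and [S],
    and the cross term of [(x + r y)^2] is absorbed by [b1 S + b2 P] through the inequality of
    arithmetic and geometric means. *)
Lemma julia_inequality_mul (x y r q A B b1 b2 : R) : 0 <= x -> 0 <= y -> 0 <= r -> r <= 1 ->
  0 <= q -> q <= 1 ->
  0 <= A -> 0 <= B -> 0 <= b1 -> 0 <= b2 ->
  x ^+ 2 * A <= b1 * B * (1 - r ^+ 2) -> y ^+ 2 * A <= b2 * B * (1 - q ^+ 2) ->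
  (x + r * y) ^+ 2 * A <= (b1 + b2) * B * (1 - (r * q) ^+ 2).
Proof.
move=> x0 y0 r0 r1 q0 q1 A0 B0 b10 b20 h1 h2.
set P := B * (1 - r ^+ 2); set S := B * r ^+ 2 * (1 - q ^+ 2).
have P0 : 0 <= P by rewrite mulr_ge0// subr_ge0 expr_le1.
have S0 : 0 <= S by rewrite !mulr_ge0// ?sqr_ge0// subr_ge0 expr_le1.
have h1' : x ^+ 2 * A <= b1 * P by rewrite /P mulrA.
have h2' : r ^+ 2 * y ^+ 2 * A <= b2 * S.
  have := ler_wpM2l (sqr_ge0 r) h2; rewrite /S.
  by congr (_ <= _); ring.
have cross : 2 * (x * (r * y) * A) <= b1 * S + b2 * P.
  rewrite -(ler_pXn2r (n:=2)) ?nnegrE//; last 2 first.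
  - by rewrite !mulr_ge0.
  - by apply: addr_ge0; apply: mulr_ge0.
  have h3 : (x ^+ 2 * A) * (r ^+ 2 * y ^+ 2 * A) <= (b1 * P) * (b2 * S).
    by apply: ler_pM => //; rewrite !mulr_ge0 ?sqr_ge0.
  have h4 : 0 <= (b1 * S - b2 * P) ^+ 2 by exact: sqr_ge0.
  apply: (@le_trans _ _ (4 * ((b1 * P) * (b2 * S)))); last first.
    by rewrite -subr_ge0; move: h4; congr (_ <= _); ring.
  by move: h3; rewrite -(ler_pM2l (_ : 0 < 4)) //; congr (_ <= _); ring.
have -> : (b1 + b2) * B * (1 - (r * q) ^+ 2) = b1 * P + b2 * S + (b1 * S + b2 * P).
  by rewrite /P /S; ring.
have -> : (x + r * y) ^+ 2 * A = x ^+ 2 * A + r ^+ 2 * y ^+ 2 * A + 2 * (x * (r * y) * A) by ring.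
by rewrite !lerD.
Qed.

Lemma inner_likeM g1 g2 b1 b2 : inner_like g1 b1 -> inner_like g2 b2 ->
  inner_like (fun z => g1 z * g2 z) (fun xi => b1 xi + b2 xi).
Proof.
move=> [c1 d1 p1 [K1 K10 l1] j1 [F1 f1] e1] [c2 d2 p2 [K2 K20 l2] j2 [F2 f2] e2]; split.
- by move=> xi h; rewrite modulusM c1// c2// mulr1.
- by move=> z h; rewrite modulusM mulr_ile1 ?modulus_ge0// ?d1// d2.
- by move=> xi h; rewrite addr_ge0 ?p1 ?p2.
- exists (K1 + K2); first by rewrite addr_ge0.
  move=> xi zeta h1 h2.
  have -> : b1 xi + b2 xi - (b1 zeta + b2 zeta) = (b1 xi - b1 zeta) + (b2 xi - b2 zeta) by ring.
  by apply: le_trans (ler_normD _ _) _; rewrite mulrDl lerD ?l1 ?l2.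
- move=> xi z hx hz.
  have z2 : 0 <= 1 - modulus z ^+ 2 by rewrite subr_ge0 expr_le1 ?modulus_ge0// ltW.
  have := julia_inequality_mul (modulus_ge0 (g1 xi - g1 z)) (modulus_ge0 (g2 xi - g2 z)) (modulus_ge0 (g1 z))
    (d1 _ hz) (modulus_ge0 (g2 z)) (d2 _ hz) z2 (sqr_ge0 (modulus (xi - z))) (p1 _ hx) (p2 _ hx)
    (j1 _ _ hx hz) (j2 _ _ hx hz).
  rewrite modulusM; apply: le_trans; rewrite ler_wpM2r// ler_pXn2r ?nnegrE ?modulus_ge0//.
    have -> : g1 xi * g2 xi - g1 z * g2 z = (g1 xi - g1 z) * g2 xi + g1 z * (g2 xi - g2 z) by ring.
    by apply: le_trans (modulusD _ _) _; rewrite !modulusM (c2 _ hx) mulr1.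
  by rewrite addr_ge0 ?mulr_ge0 ?modulus_ge0.
- exists (fun t => F1 t + F2 t) => t; have [f11 f12] := f1 t; have [f21 f22] := f2 t; split.
    by rewrite f11 f21 expi2piD.
  exact: is_deriveD.
- move=> xi hx; have := is_deriveM (e1 _ hx) (e2 _ hx).
  have -> : g1 xi *: ((b2 xi)%:C%C * g2 xi / xi) + g2 xi *: ((b1 xi)%:C%C * g1 xi / xi)
    = (b1 xi + b2 xi)%:C%C * (g1 xi * g2 xi) / xi :> R[i]; last by [].
  by rewrite /GRing.scale/= rmorphD/=; ring.
Qed.

Lemma inner_like_cst a : modulus a = 1 -> inner_like (fun=> a) (fun=> 0).
Proof.
move=> a1; split => //.
- by move=> z _; rewrite a1.
- by exists 0 => // *; rewrite subrr normr0 mul0r.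
- by move=> xi z _ _; rewrite subrr modulus0 expr0n/= mul0r !mul0r.
- have [u ->] := expi2pi_surj a1; exists (fun=> u) => t; split => //.
  exact: is_derive_cst.
- by move=> xi _; rewrite mul0r mul0r; exact: is_derive_cst.
Qed.

Lemma inner_like_id : inner_like id (fun=> 1).
Proof.
split => //.
- by move=> z /ltW.
- by exists 0 => // *; rewrite subrr normr0 mul0r.
- by move=> xi z _ _; rewrite mul1r.
- by exists id => t; split => //; exact: is_derive_id.
- move=> xi h; rewrite mul1r divff; first exact: is_derive_id.
  exact: modulus1_neq0 h.
Qed.

Definition bfactor w z := (z - w) / (1 - w^* * z).
(** The Poisson kernel of the disk at [w]. It is at once the modulus of the derivative of
    [bfactor w] on the circle, the derivative of its lift, and its coefficient in Julia's lemma. *)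
Definition bpoisson w xi := (1 - modulus w ^+ 2) / modulus (xi - w) ^+ 2.

Lemma bfactor_den w z : modulus w < 1 -> modulus z <= 1 -> 0 < modulus (1 - w^* * z).
Proof.
move=> w1 z1; apply: (@lt_le_trans _ _ (1 - modulus w)); first by rewrite subr_gt0.
have := modulus_le_add 1 (w^* * z); rewrite modulus1 modulusM modulusJ => h.
have : modulus w * modulus z <= modulus w * 1 by rewrite ler_wpM2l ?modulus_ge0.
lra.
Qed.

Lemma bfactor_identity w z : modulus w < 1 -> modulus z <= 1 ->
  1 - modulus (bfactor w z) ^+ 2 =
  (1 - modulus w ^+ 2) * (1 - modulus z ^+ 2) / modulus (1 - w^* * z) ^+ 2.
Proof.
move=> w1 z1; have d0 := bfactor_den w1 z1; have dn := lt0r_neq0 d0.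
apply: (mulIf (expf_neq0 2 dn)); rewrite mulfVK ?expf_neq0//.
rewrite /bfactor modulusM modulusV mulrBl mul1r exprMn exprVn mulfVK ?expf_neq0//.
rewrite !modulus_sqr; case: w z {w1 z1 d0 dn} => [u v] [x y] /=; ring.
Qed.

Lemma bfactor_den_circle w xi : modulus xi = 1 -> modulus (1 - w^* * xi) = modulus (xi - w).
Proof.
move=> h; have h2 := modulus_sqr xi; rewrite h expr1n in h2.
apply/eqP; rewrite -(@eqrXn2 _ 2)// ?modulus_ge0//; apply/eqP.
rewrite !modulus_sqr; case: w xi {h} h2 => [u v] [x y] /= h2.
apply/eqP; rewrite -subr_eq0.
set a := (_ - _); have ->
  : a = (1 - (x ^+ 2 + y ^+ 2)) * (1 - (u ^+ 2 + v ^+ 2)) by rewrite /a; ring.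
by rewrite -h2 subrr mul0r.
Qed.

Lemma modulus_sub_gt0 w xi : modulus w < 1 -> modulus xi = 1 -> 1 - modulus w <= modulus (xi - w).
Proof. by move=> w1 h; have := modulus_le_add xi w; rewrite h; lra. Qed.

Lemma bpoisson_ge w xi : modulus w < 1 -> modulus xi = 1 ->
  (1 - modulus w ^+ 2) / 4 <= bpoisson w xi.
Proof.
move=> w1 h; have w0 := modulus_ge0 w.
have d0 : 0 < modulus (xi - w) by apply: lt_le_trans (modulus_sub_gt0 w1 h); lra.
rewrite /bpoisson ler_wpM2l ?subr_ge0 ?expr_le1 ?(ltW w1)//.
rewrite lef_pV2 ?posrE ?exprn_gt0//.
have : modulus (xi - w) <= 2 by apply: le_trans (modulus_sub_le _ _) _; rewrite h; lra.
by nra.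
Qed.

Lemma bpoisson_gt0 w xi : modulus w < 1 -> modulus xi = 1 -> 0 < bpoisson w xi.
Proof.
move=> w1 h; have w0 := modulus_ge0 w; apply: lt_le_trans (bpoisson_ge w1 h).
by rewrite divr_gt0// subr_gt0 expr_lt1.
Qed.

(** For an automorphism of the disk Julia's lemma is an equality; inequality only appears when
    factors are multiplied. *)
Lemma bfactor_julia w xi z : modulus w < 1 -> modulus xi = 1 -> modulus z < 1 ->
  modulus (bfactor w xi - bfactor w z) ^+ 2 * (1 - modulus z ^+ 2)
      = bpoisson w xi * modulus (xi - z) ^+ 2 * (1 - modulus (bfactor w z) ^+ 2).
Proof.
move=> w1 h z1; have d1 := bfactor_den w1 (ltW z1).
have d2 : 0 < modulus (1 - w^* * xi) by apply: bfactor_den => //; rewrite h.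
have n1 : 1 - w^* * z != 0 by apply: contraTneq d1 => ->; rewrite modulus0 ltxx.
have n2 : 1 - w^* * xi != 0 by apply: contraTneq d2 => ->; rewrite modulus0 ltxx.
have -> : bfactor w xi - bfactor w z = (xi - z) * (1 - w * w^*) / ((1 - w^* * xi) * (1 - w^* * z)).
  by rewrite /bfactor; field; rewrite n1 n2.
have hw : modulus (1 - w * w^*) = 1 - modulus w ^+ 2.
  have -> : 1 - w * w^* = (1 - modulus w ^+ 2)%:C%C.
    rewrite modulus_sqr; case: w {w1 d1 d2 n1 n2} => u v.
    by apply/eqP; rewrite eq_complex /=; apply/andP; split; apply/eqP; ring.
  by rewrite modulus_real// subr_ge0 expr_le1 ?modulus_ge0 ?ltW.
rewrite bfactor_identity ?(ltW z1)// !(modulusM, modulusV) hw /bpoisson -(bfactor_den_circle w h).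
by field; rewrite !lt0r_neq0.
Qed.

(* On the circle [bfactor w z = z * (q^* / q)] with [q = 1 - w^* z] of positive
   real part, so that [q^* / q] has argument [- 2 atan (Im q / Re q)]. *)
Lemma bfactor_lift w : modulus w < 1 -> exists F : R -> R, forall t,
  bfactor w (e t) = e (F t) /\ is_derive t 1 F (bpoisson w (e t)).
Proof.
move=> w1.
pose q t := (1 - w^* * e t).
pose X t := 1 - (complex.Re w * cos (2 * pi * t) + complex.Im w * sin (2 * pi * t)).
pose Y t := complex.Im w * cos (2 * pi * t) - complex.Re w * sin (2 * pi * t).
have qE t : q t = (X t +i* Y t)%C.
  have wE : w = (complex.Re w +i* complex.Im w)%C by case: (w).
  rewrite /q /X /Y {1}wE; set u := complex.Re w; set v := complex.Im w.
  by apply/eqP; rewrite eq_complex /=; apply/andP; split; apply/eqP; ring.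
have X0 t : 0 < X t.
  rewrite /X subr_gt0.
  have := modulus_Re (w^* * e t); rewrite modulusM modulusJ modulus_expi2pi mulr1 => h.
  apply: le_lt_trans w1; apply: le_trans h.
  by case: (w) => u v /=; rewrite mulNr opprK.
have dX t : is_derive t 1 X (- (2 * pi) * Y t).
  have h := is_deriveB (is_derive_cst (1 : R) t 1) (is_deriveD (is_derive_mull (complex.Re w) (is_derive_cos2pi t))
     (is_derive_mull (complex.Im w) (is_derive_sin2pi t))).
  by apply: is_derive_ext h _ _ => //; rewrite /Y; ring.
have dY t : is_derive t 1 Y (2 * pi * (X t - 1)).
  have h := is_deriveB (is_derive_mull (complex.Im w) (is_derive_cos2pi t))
     (is_derive_mull (complex.Re w) (is_derive_sin2pi t)).
  by apply: is_derive_ext h _ _ => //; rewrite /X; ring.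
have pi0 : (pi : R) != 0 by rewrite gt_eqF ?pi_gt0.
exists (fun t => t - pi^-1 * atan (Y t / X t)) => t; split.
  rewrite expi2piD.
  set a := atan _.
  have ca0 : cos a != 0 by rewrite gt_eqF// cos_gt0_pihalf// atan_gtNpi2 atan_ltpi2.
  have sE : X t * sin a = Y t * cos a.
    have : tan a = Y t / X t by rewrite /a atanK.
    rewrite /tan => h; apply: (mulIf (invr_neq0 ca0)).
    by rewrite -mulrA h mulfK// mulrC divfK// lt0r_neq0.
  have cs : cos a ^+ 2 + sin a ^+ 2 = 1 by exact: cos2Dsin2.
  have qn : q t != 0.
    by rewrite qE; apply/eqP => -[h _]; have := X0 t; rewrite h ltxx.
  apply: (mulIf qn); rewrite /bfactor divfK//.
  have -> : e t - w = e t * (q t)^*.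
    have ee : e t * (e t)^* = 1 by rewrite -sqr_normc normcE_modulus modulus_expi2pi expr1n.
    have -> : (q t)^* = 1 - w * (e t)^* by rewrite /q conjcB conjcM conjcK conjc1.
    by rewrite mulrBr mulr1 mulrCA ee mulr1.
  rewrite -mulrA; congr (_ * _); rewrite qE /expi2pi.
  have -> : 2 * pi * - (pi^-1 * a) = - (a + a) by rewrite mulrN mulrA -(mulrA 2) mulfV// mulr1 mulr_natl mulr2n.
  rewrite cosN sinN cosD sinD -!expr2.
  apply/eqP; rewrite eq_complex /=; apply/andP; split; apply/eqP.
    have -> : (cos a ^+ 2 - sin a ^+ 2) * X t - - (sin a * cos a + cos a * sin a) * Y t
      = (cos a ^+ 2 + sin a ^+ 2) * X t + 2 * sin a * (Y t * cos a - X t * sin a) by ring.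
    by rewrite cs sE subrr mulr0 addr0 mul1r.
  have -> : (cos a ^+ 2 - sin a ^+ 2) * Y t + - (sin a * cos a + cos a * sin a) * X t
      = - (cos a ^+ 2 + sin a ^+ 2) * Y t + 2 * cos a * (Y t * cos a - X t * sin a) by ring.
  by rewrite cs sE subrr mulr0 addr0 mulN1r.
have Xn : X t != 0 by rewrite lt0r_neq0.
have dQ : is_derive t 1 (fun s => Y s / X s)
    (Y t *: (- X t ^- 2 *: (- (2 * pi) * Y t)) + (X t)^-1 *: (2 * pi * (X t - 1))).
  exact: is_deriveM (dY t) (is_deriveV Xn (dX t)).
have h := is_deriveB (is_derive_id t 1) (is_derive_mull pi^-1
  (@is_derive1_comp _ _ _ t _ _ (is_derive1_atan (Y t / X t)) dQ)).
apply: is_derive_ext h _ _ => //.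
have qq : modulus (e t - w) ^+ 2 = X t ^+ 2 + Y t ^+ 2.
  by rewrite -bfactor_den_circle ?modulus_expi2pi// -/(q t) modulus_sqr qE.
have qq0 : X t ^+ 2 + Y t ^+ 2 != 0 by rewrite lt0r_neq0// ltr_wpDr ?sqr_ge0// exprn_gt0.
have ww : 1 - modulus w ^+ 2 = 2 * X t - (X t ^+ 2 + Y t ^+ 2).
  have cs := cos2Dsin2 (2 * pi * t).
  rewrite modulus_sqr /X /Y; set c := cos _ in cs *; set s := sin _ in cs *.
  set u := complex.Re w; set v := complex.Im w.
  apply/eqP; rewrite -subr_eq0; set d := (_ - _).
  have -> : d = (c ^+ 2 + s ^+ 2 - 1) * (u ^+ 2 + v ^+ 2) by rewrite /d; ring.
  by rewrite cs subrr mul0r.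
rewrite /bpoisson qq ww /GRing.scale/=.
move: (pi : R) pi0 => p p0.
by field; rewrite qq0 Xn p0.
Qed.

Lemma bpoisson_lipschitz w : modulus w < 1 -> exists2 K, 0 <= K & forall xi zeta,
  modulus xi = 1 -> modulus zeta = 1 ->
  `|bpoisson w xi - bpoisson w zeta| <= K * modulus (xi - zeta).
Proof.
move=> w1; have w0 := modulus_ge0 w; set r := 1 - modulus w.
have r0 : 0 < r by rewrite subr_gt0.
(* Over a common denominator, 4 bounds the sum of the two distances to [w], each at most 2, and
   [r ^+ 4] bounds the denominator from below. *)
exists (4 / r ^+ 4); first by rewrite divr_ge0// exprn_ge0// ltW.
move=> xi zeta h1 h2.
have a1 := modulus_sub_gt0 w1 h1; have a2 := modulus_sub_gt0 w1 h2; rewrite -/r in a1 a2.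
have b1 : modulus (xi - w) <= 2 by apply: le_trans (modulus_sub_le _ _) _; rewrite h1; lra.
have b2 : modulus (zeta - w) <= 2 by apply: le_trans (modulus_sub_le _ _) _; rewrite h2; lra.
have tri : `|modulus (zeta - w) - modulus (xi - w)| <= modulus (xi - zeta).
  have t1 : modulus (zeta - w) <= modulus (zeta - xi) + modulus (xi - w).
    by rewrite -{1}(subrK xi zeta) -addrA modulusD.
  have t2 : modulus (xi - w) <= modulus (xi - zeta) + modulus (zeta - w).
    by rewrite -{1}(subrK zeta xi) -addrA modulusD.
  by rewrite ler_norml; rewrite (modulusB zeta xi) in t1; apply/andP; split; lra.
rewrite /bpoisson; move: a1 a2 b1 b2 tri (modulus_ge0 (xi - zeta)).
set A := modulus (xi - w); set B := modulus (zeta - w); set D := modulus (xi - zeta).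
move=> a1 a2 b1 b2 tri D0.
have A0 : 0 < A by apply: lt_le_trans a1.
have B0 : 0 < B by apply: lt_le_trans a2.
have -> : (1 - modulus w ^+ 2) / A ^+ 2 - (1 - modulus w ^+ 2) / B ^+ 2 =
   (1 - modulus w ^+ 2) * ((B - A) * (B + A)) / (A ^+ 2 * B ^+ 2).
  by field; rewrite !lt0r_neq0.
have AB0 : 0 <= A ^+ 2 * B ^+ 2 by apply: mulr_ge0; exact: sqr_ge0.
rewrite !normrM normfV (ger0_norm AB0).
have i1 : (A ^+ 2 * B ^+ 2)^-1 <= (r ^+ 4)^-1.
  rewrite lef_pV2 ?posrE ?mulr_gt0 ?exprn_gt0//.
  have -> : r ^+ 4 = r ^+ 2 * r ^+ 2 by ring.
  have r2 (c : R) : r <= c -> r ^+ 2 <= c ^+ 2.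
    by move=> rc; rewrite ler_pXn2r// nnegrE ltW// (lt_le_trans r0).
  by apply: ler_pM (sqr_ge0 _) (sqr_ge0 _) (r2 _ a1) (r2 _ a2).
have i2 : `|1 - modulus w ^+ 2| * (`|B - A| * `|B + A|) <= 4 * D.
  have -> : 4 * D = 1 * (D * 4) by ring.
  apply: ler_pM => //.
    by rewrite ger0_norm ?subr_ge0 ?expr_le1 ?(ltW w1)// gerBl sqr_ge0.
  apply: ler_pM => //.
  by rewrite ger0_norm; [lra|apply: addr_ge0; exact: ltW].
rewrite [leRHS]mulrAC; apply: ler_pM => //.
by rewrite invr_ge0.
Qed.

Lemma bfactor_derive w xi : modulus w < 1 -> modulus xi = 1 ->
  is_derive xi 1 (bfactor w) ((bpoisson w xi)%:C%C * bfactor w xi / xi).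
Proof.
move=> w1 h.
have d2 : 0 < modulus (1 - w^* * xi) by apply: bfactor_den => //; rewrite h.
have n2 : 1 - w^* * xi != 0 by apply: contraTneq d2 => ->; rewrite modulus0 ltxx.
have xi0 := modulus1_neq0 h.
have dn : is_derive xi 1 (fun z => z - w) (1 : R[i]).
  by have := is_deriveB (is_derive_id xi 1) (is_derive_cst w xi 1); rewrite subr0.
have dd : is_derive xi 1 (fun z => 1 - w^* * z) (- w^*).
  have := is_deriveB (is_derive_cst (1 : R[i]) xi 1) (@is_deriveZ _ _ _ id (w^*) xi 1 1 (is_derive_id xi 1)).
  by rewrite sub0r /GRing.scale/= mulr1.
have dV : is_derive xi 1 (fun z => (1 - w^* * z)^-1) (- (1 - w^* * xi) ^- 2 *: (- w^*)).
  case: dd => dd1 dd2; split; first exact: derivableV.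
  by rewrite deriveV// dd2.
have := is_deriveM dn dV; congr (is_derive _ _ _ _).
have xx : xi * xi^* = 1 by rewrite -sqr_normc normcE_modulus h expr1n.
have xiw : xi - w != 0.
  have := modulus_sub_gt0 w1 h; apply: contraTneq => ->; rewrite modulus0 -ltNge; lra.
have xiwJ : xi^* - w^* != 0.
  by rewrite -conjcB conjc_eq0.
have hb : (bpoisson w xi)%:C%C = (1 - w * w^*) / ((xi - w) * (xi^* - w^*)).
  rewrite /bpoisson rmorphM fmorphV rmorphB rmorph1 !rmorphXn/= -!normcE_modulus !sqr_normc.
  by rewrite conjcB.
have hq : xi^* - w^* = (1 - w^* * xi) / xi.
  by apply: (mulIf xi0); rewrite mulfVK// mulrBl mulrC xx.
rewrite hb hq /bfactor /GRing.scale/=.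
by field; rewrite xi0 xiw n2.
Qed.

Lemma bfactor_disk w z : modulus w < 1 -> modulus z <= 1 -> modulus (bfactor w z) <= 1.
Proof.
move=> w1 z1; rewrite -(@expr_le1 _ 2)// ?modulus_ge0// -subr_ge0 bfactor_identity//.
by rewrite divr_ge0 ?sqr_ge0// mulr_ge0// subr_ge0 expr_le1 ?modulus_ge0 ?(ltW w1).
Qed.

Lemma bfactor_circle w xi : modulus w < 1 -> modulus xi = 1 -> modulus (bfactor w xi) = 1.
Proof.
move=> w1 h; have := @bfactor_identity w xi w1; rewrite h lexx => /(_ isT).
rewrite expr1n subrr mulr0 mul0r => /eqP; rewrite subr_eq0 eq_sym => /eqP h1.
by apply/eqP; rewrite -(@eqrXn2 _ 2)// ?modulus_ge0// h1 expr1n.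
Qed.

Lemma bfactor_contract w z r : modulus w < 1 -> modulus z <= r -> r < 1 ->
  modulus (bfactor w z) ^+ 2 <= 1 - (1 - modulus w ^+ 2) * (1 - r ^+ 2) / 4.
Proof.
move=> w1 zr r1.
have z0 := modulus_ge0 z; have r0 : 0 <= r by apply: le_trans zr.
have z1 : modulus z <= 1 by apply: le_trans zr (ltW r1).
have d0 := bfactor_den w1 z1.
have w2 : 0 <= 1 - modulus w ^+ 2 by rewrite subr_ge0 expr_le1 ?modulus_ge0 ?ltW.
have h := bfactor_identity w1 z1.
suff : (1 - modulus w ^+ 2) * (1 - r ^+ 2) / 4 <= 1 - modulus (bfactor w z) ^+ 2 by lra.
rewrite h; apply: ler_pM.
- by rewrite mulr_ge0// subr_ge0 expr_le1// ltW.
- by rewrite invr_ge0.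
- by rewrite ler_wpM2l// lerB// ler_pXn2r ?nnegrE.
rewrite lef_pV2 ?posrE ?exprn_gt0//.
have : modulus (1 - w^* * z) <= 2.
  apply: le_trans (modulus_sub_le _ _) _; rewrite modulus1 modulusM modulusJ.
  have := mulr_ile1 (modulus_ge0 w) z0 (ltW w1) z1; lra.
nra.
Qed.

Lemma inner_like_bfactor w : modulus w < 1 -> inner_like (bfactor w) (bpoisson w).
Proof.
move=> w1; split.
- by move=> xi; exact: bfactor_circle.
- by move=> z /ltW; exact: bfactor_disk.
- by move=> xi h; exact: ltW (bpoisson_gt0 _ _).
- exact: bpoisson_lipschitz.
- by move=> xi z h z1; rewrite bfactor_julia.
- exact: bfactor_lift.
- by move=> xi; exact: bfactor_derive.
Qed.

Lemma inner_like_exp m : inner_like (fun z => z ^+ m) (fun=> m%:R).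
Proof.
elim: m => [|m IH].
  have -> : (fun z : R[i] => z ^+ 0) = (fun=> 1) by apply/funext => z; rewrite expr0.
  exact: inner_like_cst modulus1.
have -> : (fun z : R[i] => z ^+ m.+1) = (fun z => z * z ^+ m) by apply/funext => z; rewrite exprS.
have -> : (fun=> m.+1%:R) = (fun xi : R[i] => 1 + m%:R) :> (R[i] -> R) by apply/funext => z;
  rewrite -natr1 addrC.
exact: inner_likeM inner_like_id IH.
Qed.

Lemma inner_like_prod (l : seq R[i]) : (forall w, w \in l -> modulus w < 1) ->
  inner_like (fun z => \prod_(w <- l) bfactor w z) (fun xi => \sum_(w <- l) bpoisson w xi).
Proof.
elim: l => [|w l IH] hl.
  have -> : (fun z => \prod_(w <- [::]) bfactor w z) = (fun=> 1) by apply/funext => z;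
    rewrite big_nil.
  have -> : (fun xi => \sum_(w <- [::]) bpoisson w xi) = (fun=> 0) by apply/funext => z;
    rewrite big_nil.
  exact: inner_like_cst modulus1.
have -> : (fun z => \prod_(u <- w :: l) bfactor u z) = (fun z => bfactor w z * \prod_(u <- l) bfactor u z).
  by apply/funext => z; rewrite big_cons.
have -> : (fun xi => \sum_(u <- w :: l) bpoisson u xi) = (fun xi => bpoisson w xi + \sum_(u <- l) bpoisson u xi).
  by apply/funext => z; rewrite big_cons.
apply: inner_likeM; first by apply: inner_like_bfactor; apply: hl; rewrite mem_head.
by apply: IH => u ul; apply: hl; rewrite inE ul orbT.
Qed.

(** A uniform form of Schwarz's lemma on each smaller disk. The factor [modulus z] on the right
    makes the estimate iterable and forces [f 0 = 0]. *)
Definition contracting (f : R[i] -> R[i]) := forall r : R, 0 <= r -> r < 1 ->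
  exists k : R, [/\ 0 <= k, k < 1 & forall z, modulus z <= r -> modulus (f z) <= k * modulus z].

Lemma prod_bfactor_disk (l : seq R[i]) z : (forall w, w \in l -> modulus w < 1) -> modulus z <= 1 ->
  modulus (\prod_(w <- l) bfactor w z) <= 1.
Proof.
move=> hl z1; elim: l hl => [|w l IH] hl; first by rewrite big_nil modulus1.
rewrite big_cons modulusM mulr_ile1 ?modulus_ge0//.
  by apply: bfactor_disk => //; apply: hl; rewrite mem_head.
by apply: IH => u ul; apply: hl; rewrite inE ul orbT.
Qed.

(** Not being a rotation means having a second zero: either [m] is at least 2 or some factor
    [bfactor w] is present. That zero supplies both the excess of [b] over 1 and the contraction
    inside the disk. *)
Lemma blaschke_structure f : is_blaschke0 f -> ~ is_rotation f ->
  exists b, [/\ inner_like f b,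
    exists2 lam : R, 1 < lam & forall xi, modulus xi = 1 -> lam <= b xi
    & contracting f].
Proof.
move=> [alpha [m [l [a1 m0 hl ->]]]] nrot.
rewrite modulus_eq1 in a1.
have hl1 w : w \in l -> modulus w < 1 by move=> /hl; rewrite /unit_disk/= modulus_lt1.
(* The leading 0 belongs to the constant factor [alpha]; this is the shape that [inner_likeM]
   produces. *)
exists (fun xi => 0 + m%:R + \sum_(w <- l) bpoisson w xi).
have bp xi (k : seq R[i]) : (forall w, w \in k -> modulus w < 1) -> modulus xi = 1 ->
  0 <= \sum_(w <- k) bpoisson w xi.
  by move=> hk h; rewrite big_seq; apply: sumr_ge0 => w /hk wk; apply: ltW (bpoisson_gt0 _ _).
split.
- exact: inner_likeM (inner_likeM (inner_like_cst a1) (inner_like_exp m)) (inner_like_prod hl1).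
- have [m2|m1] := leqP 2 m.
    exists 2; first by lra.
    move=> xi h; rewrite add0r; have := bp xi l hl1 h; have : (2 : R) <= m%:R by rewrite ler_nat.
    lra.
  have {m0 m1}mE : m = 1 by lia.
  move: nrot hl1; rewrite mE; case: l {hl} => [|w l] nrot hl1.
    by case: nrot; exists alpha; [rewrite modulus_eq1|move=> z;
      rewrite /blaschke big_nil mulr1 expr1].
  have w1 : modulus w < 1 by apply: hl1; rewrite mem_head.
  have w2 : 0 < 1 - modulus w ^+ 2 by rewrite subr_gt0 expr_lt1 ?modulus_ge0.
  exists (1 + (1 - modulus w ^+ 2) / 4); first by rewrite ltrDl divr_gt0.
  move=> xi h; rewrite add0r big_cons addrA -[leLHS]addr0; apply: lerD.
    by rewrite lerD2l bpoisson_ge.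
  by apply: bp => // u ul; apply: hl1; rewrite inE ul orbT.
- move=> r r0 r1; have [m2|m1] := leqP 2 m.
    exists r; split => // z zr; rewrite /blaschke !modulusM a1 mul1r modulusX.
    have z1 : modulus z <= 1 by apply: le_trans zr (ltW r1).
    have -> : r * modulus z = r * modulus z * 1 by rewrite mulr1.
    apply: ler_pM; rewrite ?exprn_ge0 ?modulus_ge0//; last exact: prod_bfactor_disk.
    apply: (@le_trans _ _ (modulus z ^+ 2)); first by apply: ler_wiXn2l => //; rewrite modulus_ge0.
    by rewrite expr2 ler_wpM2r ?modulus_ge0.
  have {m0 m1}mE : m = 1 by lia.
  move: nrot hl1; rewrite mE; case: l {hl bp} => [|w l] nrot hl1.
    by case: nrot; exists alpha; [rewrite modulus_eq1|move=> z;
      rewrite /blaschke big_nil mulr1 expr1].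
  have w1 : modulus w < 1 by apply: hl1; rewrite mem_head.
  set q := 1 - (1 - modulus w ^+ 2) * (1 - r ^+ 2) / 4.
  have p0 : 0 < (1 - modulus w ^+ 2) * (1 - r ^+ 2).
    by rewrite mulr_gt0 ?subr_gt0 ?expr_lt1 ?modulus_ge0.
  have p1 : (1 - modulus w ^+ 2) * (1 - r ^+ 2) <= 1.
    by rewrite mulr_ile1 ?subr_ge0 ?expr_le1 ?modulus_ge0 ?(ltW w1) ?(ltW r1)// gerBl sqr_ge0.
  exists (Num.sqrt q); split; first exact: sqrtr_ge0.
    by rewrite -[ltRHS]sqrtr1 ltr_sqrt// /q; lra.
  move=> z zr; rewrite /blaschke !modulusM a1 mul1r expr1 big_cons modulusM mulrC.
  apply: ler_wpM2r; first exact: modulus_ge0.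
  have z1 : modulus z <= 1 by apply: le_trans zr (ltW r1).
  have h1 := bfactor_contract w1 zr r1.
  rewrite -[leRHS]mulr1; apply: ler_pM; rewrite ?modulus_ge0//.
    by rewrite -[leLHS]ger0_norm ?modulus_ge0// -sqrtr_sqr ler_sqrt// (le_trans (sqr_ge0 _) h1).
  by apply: prod_bfactor_disk => // u ul; apply: hl1; rewrite inE ul orbT.
Qed.

Lemma min_deriv_gt1 f b (lam : R) : inner_like f b -> 1 < lam ->
  (forall xi, modulus xi = 1 -> lam <= b xi) -> 1 < min_deriv f.
Proof.
move=> hf l1 hb; apply: (lt_le_trans l1); rewrite /min_deriv; apply: lb_le_inf.
  by exists (modulus (derive1 f 1)); exists 1 => //; rewrite /unit_circle/= normr1.
move=> y [xi]; rewrite /unit_circle/= modulus_eq1 => h <-.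
have [_] := inner_derive hf h; rewrite derive1E => ->.
rewrite !modulusM modulusV h (inner_circle hf h) invr1 !mulr1 modulus_real.
  exact: hb.
exact: inner_ge0 hf _ h.
Qed.

End blaschke_like.

(** * Expansion and distortion of the iterates *)

Section dynamics.
Context {R : realType}.
Implicit Types (s t x y : R) (z w xi : R[i]).
Local Notation e := (@expi2pi R).
Variables (f : R[i] -> R[i]) (b : R[i] -> R) (F : R -> R) (lam L : R).
Hypothesis hf : inner_like f b.
Hypothesis lam1 : 1 < lam.
Hypothesis hlam : forall xi, modulus xi = 1 -> lam <= b xi.
Hypothesis liftF : forall t, f (e t) = e (F t).
Hypothesis derF : forall t, is_derive t 1 F (b (e t)).
Hypothesis L0 : 0 <= L.
Hypothesis lipb : forall s t, `|b (e s) - b (e t)| <= L * `|s - t|.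
Hypothesis diskf : forall z, modulus z < 1 -> modulus (f z) < 1.

Let lam0 : 0 < lam. Proof. exact: lt_trans lam1. Qed.

Lemma lift_iter n t : iter n f (e t) = e (iter n F t).
Proof. by elim: n => //= n ->. Qed.

Lemma lift_continuous : continuous F.
Proof.
move=> t; apply: differentiable_continuous; apply/derivable1_diffP.
by case: (derF t).
Qed.

Lemma lift_MVT x y : x <= y -> exists s, x <= s <= y /\ F y - F x = b (e s) * (y - x).
Proof.
rewrite le_eqVlt => /predU1P[->|xy]; first by exists y; rewrite lexx !subrr mulr0.
have [|s] := @MVT R F (fun s => b (e s)) x y xy (fun s _ => derF s).
  exact: continuous_subspaceT lift_continuous.
by rewrite in_itv/= => /andP[/ltW h1 /ltW h2] h; exists s; rewrite h1 h2.
Qed.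

Lemma lift_expand x y : x <= y -> lam * (y - x) <= F y - F x.
Proof.
move=> xy; have [s [_ ->]] := lift_MVT xy.
by rewrite ler_wpM2r ?subr_ge0// hlam// modulus_expi2pi.
Qed.

Lemma lift_mono x y : x <= y -> F x <= F y.
Proof.
move=> xy; rewrite -subr_ge0; apply: le_trans (lift_expand xy).
by rewrite mulr_ge0 ?subr_ge0// ltW.
Qed.

Lemma lift_iter_mono n x y : x <= y -> iter n F x <= iter n F y.
Proof. by move=> xy; elim: n => //= n IH; exact: lift_mono. Qed.

Lemma lift_iter_expand n m x y : x <= y ->
  lam ^+ m * (iter n F y - iter n F x) <= iter (m + n) F y - iter (m + n) F x.
Proof.
move=> xy; elim: m => [|m IH]; first by rewrite mul1r.
rewrite addSn !iterS exprS -mulrA; apply: le_trans (lift_expand (lift_iter_mono _ xy)).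
by rewrite ler_wpM2l// ltW.
Qed.

Lemma lift_iter_continuous n : continuous (iter n F).
Proof.
elim: n => [|n IH] t; first exact: cvg_id.
by apply: (@continuous_comp _ _ _ (iter n F) F); [exact: IH|exact: lift_continuous].
Qed.

Lemma lift_iter_IVT n x y c : x <= y -> iter n F x <= c <= iter n F y ->
  exists2 t, x <= t <= y & iter n F t = c.
Proof.
move=> xy hc; have [||t] := @IVT R (iter n F) x y c xy.
- by apply: (@continuous_subspaceT _ _ _ (iter n F)); exact: lift_iter_continuous.
- rewrite (minElt _ _) (maxElt _ _).
  have := lift_iter_mono n xy.
  by rewrite le_eqVlt => /predU1P[h|h]; [rewrite h ltxx -{1}h|rewrite h].
by rewrite in_itv/= => ht <-; exists t.
Qed.

Lemma iter_arc n x y : x <= y -> iter n f @` arc x y = arc (iter n F x) (iter n F y).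
Proof.
move=> xy; apply/seteqP; split => z.
  move=> [u [t /= + <-] <-]; rewrite in_itv/= lift_iter => /andP[t1 t2].
  by exists (iter n F t) => //=; rewrite in_itv/= !lift_iter_mono.
move=> [c /=]; rewrite in_itv/= => hc <-.
have [t ht <-] := lift_iter_IVT xy hc.
by exists (e t); [exists t => //=; rewrite in_itv|rewrite lift_iter].
Qed.

Section arc_control.
Variables (N : nat) (x y : R).
Hypothesis xy : x <= y.
Hypothesis small : circle_measure (iter N f @` arc x y) < 1.

Local Notation len n := (iter n F y - iter n F x).

(** A lifted image of length at least 1 would cover the circle and have measure 1. This is what lets
    measures of images be read as lengths on the line. *)
Lemma arc_image_lt1 : len N < 1.
Proof.
rewrite ltNge; apply/negP => h; move: small; rewrite iter_arc// circle_measure_arc_full ?ltxx//.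
lra.
Qed.

Lemma arc_image_measure : circle_measure (iter N f @` arc x y) = len N.
Proof.
rewrite iter_arc// circle_measure_arc ?lift_iter_mono//.
by have := arc_image_lt1; lra.
Qed.

(** Expansion read backwards: the image at time [N] is shorter than 1, so the one at time [n] is
    shorter than [lam ^- (N - n)]. The 16 is the Lipschitz constant of the parametrisation. *)
Lemma arc_oscillation n xi zeta : (n <= N)%N -> arc x y xi -> arc x y zeta ->
  modulus (iter n f xi - iter n f zeta) <= 16 * lam ^- (N - n).
Proof.
move=> nN [s /= + <-] [t /= + <-]; rewrite !in_itv/= => /andP[s1 s2] /andP[t1 t2].
rewrite !lift_iter; apply: le_trans (expi2pi_lipschitz _ _) _.
rewrite ler_wpM2l//.
have h1 : len n <= lam ^- (N - n).
  have := lift_iter_expand n (N - n) xy; rewrite subnK// => h.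
  rewrite -[leRHS]mul1r ler_pdivlMr ?exprn_gt0// mulrC; apply: le_trans h _.
  exact: ltW arc_image_lt1.
apply: le_trans h1; rewrite ler_norml.
have := lift_iter_mono n s1; have := lift_iter_mono n s2.
have := lift_iter_mono n t1; have := lift_iter_mono n t2.
by move=> *; apply/andP; split; lra.
Qed.

(** By the chain rule, the derivative of [iter n F] at [t]. *)
Definition deriv_iter n t := \prod_(i < n) b (e (iter i F t)).

Lemma deriv_iter_ge0 n t : 0 <= deriv_iter n t.
Proof. by apply: prodr_ge0 => i _; apply: (inner_ge0 hf); rewrite modulus_expi2pi. Qed.

Lemma len_ge0 n : 0 <= len n.
Proof. by rewrite subr_ge0 lift_iter_mono. Qed.

(** The lengths grow at least by the factor [lam], so the sum is dominated by a geometric series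
    read backwards from the last term. *)
Lemma len_sum n : \sum_(i < n) len i <= len n / (lam - 1).
Proof.
have l1 : 0 < lam - 1 by rewrite subr_gt0.
elim: n => [|n IH]; first by rewrite big_ord0 divr_ge0 ?len_ge0// ltW.
rewrite big_ord_recr/=; apply: le_trans (lerD IH (lexx _)) _.
rewrite ler_pdivlMr// mulrDl divfK ?lt0r_neq0//.
by have := lift_expand (lift_iter_mono n xy); rewrite -!iterS; lra.
Qed.

(** Each step compares [b] at the orbit of [t] with [b] at the mean value point [s]. They differ by
    at most [L * len n], and [1 <= b (e s)] turns this into the factor [1 + L * len n], hence an
    exponential. *)
Lemma distortion n t : x <= t <= y ->
  deriv_iter n t * (y - x) <= expR (L * \sum_(i < n) len i) * len n.
Proof.
move=> /andP[t1 t2]; elim: n => [|n IH].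
  by rewrite /deriv_iter !big_ord0 mulr0 expR0.
rewrite /deriv_iter !big_ord_recr/= -/(deriv_iter n t) (mulrDr L) expRD.
have [s [/andP[s1 s2] hs]] := lift_MVT (lift_iter_mono n xy).
have T1 := lift_iter_mono n t1; have T2 := lift_iter_mono n t2.
rewrite -!iterS in hs *; rewrite /= hs.
set u := iter n F t in T1 T2 *.
have bs1 : 1 <= b (e s) by apply: le_trans (ltW lam1) (hlam _); rewrite modulus_expi2pi.
have hb : b (e u) <= expR (L * len n) * b (e s).
  apply: (@le_trans _ _ ((1 + L * len n) * b (e s))); last first.
    by rewrite ler_wpM2r ?expR_ge1Dx//; lra.
  have h1 : `|u - s| <= len n by rewrite ler_norml; apply/andP; split; lra.
  have h2 : b (e u) - b (e s) <= L * len n.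
    apply: le_trans (ler_norm _) _; apply: le_trans (lipb _ _) _.
    by rewrite ler_wpM2l.
  have h3 : L * len n * 1 <= L * len n * b (e s) by rewrite ler_wpM2l// mulr_ge0 ?len_ge0.
  lra.
have b0 : 0 <= b (e u) by apply: (inner_ge0 hf); rewrite modulus_expi2pi.
have -> : deriv_iter n t * b (e u) * (y - x) = (deriv_iter n t * (y - x)) * b (e u) by ring.
apply: (@le_trans _ _ ((expR (L * \sum_(i < n) len i) * len n) * (expR (L * len n) * b (e s)))).
  by apply: ler_pM => //; rewrite mulr_ge0 ?deriv_iter_ge0 ?subr_ge0.
by rewrite le_eqVlt; apply/orP; left; apply/eqP; ring.
Qed.

(** The bound is uniform in [N]: the sum of all lengths is controlled by the last one, which is
    below 1. *)
Lemma deriv_iter_bound t : x <= t <= y -> deriv_iter N t * (y - x) <= expR (L / (lam - 1)).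
Proof.
have l1 : 0 < lam - 1 by rewrite subr_gt0.
move=> ht; apply: le_trans (distortion N ht) _.
have lN := ltW arc_image_lt1.
rewrite -[leRHS]mulr1; apply: ler_pM; rewrite ?expR_ge0 ?len_ge0//.
rewrite ler_expR ler_wpM2l//; apply: le_trans (len_sum N) _.
by rewrite ler_pdivrMr// mulVf// lt0r_neq0.
Qed.

End arc_control.

Lemma disk_iter n z : modulus z < 1 -> modulus (iter n f z) < 1.
Proof. by move=> z1; elim: n => //= n; exact: diskf. Qed.

Lemma circle_iter n xi : modulus xi = 1 -> modulus (iter n f xi) = 1.
Proof. by move=> h; elim: n => //= n; exact: (inner_circle hf). Qed.

Lemma julia_iter n t z : modulus z < 1 ->
  modulus (iter n f (e t) - iter n f z) ^+ 2 * (1 - modulus z ^+ 2)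
    <= deriv_iter n t * modulus (e t - z) ^+ 2 * (1 - modulus (iter n f z) ^+ 2).
Proof.
move=> z1; elim: n => [|n IH]; first by rewrite /deriv_iter big_ord0 mul1r.
have pz k : 0 < 1 - modulus (iter k f z) ^+ 2.
  by rewrite subr_gt0 expr_lt1 ?modulus_ge0// disk_iter.
have h := inner_julia hf (circle_iter n (modulus_expi2pi t)) (disk_iter n z1).
rewrite /= /deriv_iter big_ord_recr/= -/(deriv_iter n t) -lift_iter.
set U := modulus (f _ - f _) in h *; set V := modulus (iter n f (e t) - _) in h IH.
set B := b _ in h *; set W := modulus (e t - z) in IH *.
have B0 : 0 <= B by apply: (inner_ge0 hf); rewrite circle_iter ?modulus_expi2pi.
(* The quantity [1 - |f^n z|^2] bounds one side of the induction hypothesis and multiplies the other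
   side of the new Julia inequality; being positive, it is inserted here on both sides to chain the
   two. *)
rewrite -(ler_pM2r (pz n)) mulrAC.
apply: (@le_trans _ _ (B * V ^+ 2 * (1 - modulus (f (iter n f z)) ^+ 2) * (1 - modulus z ^+ 2))).
  by rewrite ler_wpM2r// ltW// (pz 0%N).
have -> : B * V ^+ 2 * (1 - modulus (f (iter n f z)) ^+ 2) * (1 - modulus z ^+ 2) =
  (B * (1 - modulus (f (iter n f z)) ^+ 2)) * (V ^+ 2 * (1 - modulus z ^+ 2)) by ring.
have -> : deriv_iter n t * B * W ^+ 2 * (1 - modulus (f (iter n f z)) ^+ 2) * (1 - modulus (iter n f z) ^+ 2)
  = (B * (1 - modulus (f (iter n f z)) ^+ 2)) * (deriv_iter n t * W ^+ 2 * (1 - modulus (iter n f z) ^+ 2)) by ring.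
by rewrite ler_wpM2l// mulr_ge0// ltW// (pz n.+1).
Qed.

(* Two points of the arc have images at distance [chi], so one of them is at
   distance at least [chi / 2] from the image of the centre; Julia's lemma at that
   point bounds the latter away from the circle. *)
Lemma return_bound (N d : nat) (eta s l : R) : (0 < d)%N -> 0 < l -> l <= 1 -> 0 < eta ->
  eta < 4^-1 ->
  eta <= circle_measure (iter N f @` closed_arc (e s) l) ->
  circle_measure (iter N f @` closed_arc (e s) l) <= 4 * eta ->
  modulus (iter N f (e s * (1 - l / d%:R)%:C%C)) <=
    Num.sqrt (1 - modulus (1 - e eta) ^+ 2 / (324 * d%:R * expR (L / (lam - 1)))).
Proof.
move=> d0 l0 l1 eta0 eta4; rewrite closed_arc_expi2pi.
set x := s - l / 2; set y := s + l / 2 => m1 m2.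
have dR : 1 <= d%:R :> R by rewrite (ler_nat _ 1).
have xy : x <= y by rewrite /x /y; lra.
have small : circle_measure (iter N f @` arc x y) < 1 by apply: le_lt_trans m2 _; lra.
rewrite arc_image_measure// in m1 m2.
set D := expR _; have D0 : 0 < D by exact: expR_gt0.
set z := e s * _; set chi := modulus (1 - e eta).
have ld : l / d%:R <= l by rewrite ler_pdivrMr; [rewrite ler_peMr// ltW|lra].
have ld0 : 0 < l / d%:R by rewrite divr_gt0//; lra.
have zE : modulus z = 1 - l / d%:R.
  by rewrite /z modulusM modulus_expi2pi mul1r modulus_real// subr_ge0; lra.
have z1 : modulus z < 1 by rewrite zE; lra.
set v := modulus (iter N f z).
have v0 : 0 <= v by exact: modulus_ge0.
suff main : chi ^+ 2 / (324 * d%:R * D) <= 1 - v ^+ 2.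
  rewrite -(ger0_norm v0) -sqrtr_sqr ler_wsqrtr//; lra.
have key t : x <= t <= y -> chi / 2 <= modulus (iter N f (e t) - iter N f z) ->
    chi ^+ 2 / (324 * d%:R * D) <= 1 - v ^+ 2.
  move=> ht hchi; have J := julia_iter N t z1; rewrite -/v in J.
  have hD := deriv_iter_bound xy small ht; rewrite -/D in hD.
  have yx : y - x = l by rewrite /x /y; lra.
  rewrite yx in hD.
  (* The 9 is 16 / 2 for half the arc plus 1 for the radial segment, whose length is at most [l].
     With the 4 coming from [(chi / 2) ^+ 2], this gives [324 = 4 * 81]. *)
  have dist : modulus (e t - z) <= 9 * l.
    have -> : e t - z = (e t - e s) + (e s - z) by ring.
    apply: le_trans (modulusD _ _) _.
    have -> : e s - z = e s * (l / d%:R)%:C%C by rewrite /z rmorphB rmorph1; ring.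
    rewrite modulusM modulus_expi2pi mul1r (modulus_real (ltW ld0)).
    have : `|t - s| <= l / 2 by move: ht; rewrite /x /y ler_norml => /andP[? ?]; apply/andP;
      split; lra.
    by have := expi2pi_lipschitz t s; lra.
  have v2 : 0 <= 1 - v ^+ 2 by rewrite subr_ge0 expr_le1// ltW// disk_iter.
  have s1 : (chi / 2) ^+ 2 * (l / d%:R) <= modulus (iter N f (e t) - iter N f z) ^+ 2 * (1 - modulus z ^+ 2).
    apply: ler_pM; rewrite ?sqr_ge0 ?(ltW ld0)//.
      by rewrite ler_pXn2r ?nnegrE ?modulus_ge0// divr_ge0 ?modulus_ge0.
    rewrite zE; nra.
  have s2 : deriv_iter N t * modulus (e t - z) ^+ 2 * (1 - v ^+ 2) <= D * 81 * l * (1 - v ^+ 2).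
    rewrite ler_wpM2r//.
    apply: (@le_trans _ _ (deriv_iter N t * (9 * l) ^+ 2)).
      rewrite ler_wpM2l ?deriv_iter_ge0//.
      by rewrite ler_pXn2r ?nnegrE ?modulus_ge0//; lra.
    have -> : deriv_iter N t * (9 * l) ^+ 2 = (deriv_iter N t * l) * (81 * l) by ring.
    have -> : D * 81 * l = D * (81 * l) by ring.
    by rewrite ler_wpM2r//; lra.
  have s3 := le_trans s1 (le_trans J s2).
  have den0 : 0 < 324 * d%:R * D.
    by apply: mulr_gt0; [apply: mulr_gt0; rewrite ltr0n|exact: D0].
  rewrite ler_pdivrMr; last exact: den0.
  have e1 : (chi / 2) ^+ 2 * (l / d%:R) = chi ^+ 2 * (l / (4 * d%:R)) by field; lra.
  rewrite e1 in s3.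
  have ldd : 0 < l / (4 * d%:R) by rewrite divr_gt0//; lra.
  rewrite -(ler_pM2r ldd); apply: le_trans s3 _.
  rewrite le_eqVlt; apply/orP; left; apply/eqP; field; lra.
(* The lifted image is at least [eta] long, so some point of the arc has its image exactly [eta]
   further than that of [x]; on the circle the two images are [chi] apart. *)
have [t2 ht2 ft2] : exists2 t, x <= t <= y & iter N F t = iter N F x + eta.
  by apply: lift_iter_IVT => //; apply/andP; split; lra.
have far : chi <= modulus (iter N f (e x) - iter N f z) + modulus (iter N f (e t2) - iter N f z).
  have -> : chi = modulus (iter N f (e x) - iter N f (e t2)).
    rewrite !lift_iter ft2 expi2piD.
    have -> : e (iter N F x) - e (iter N F x) * e eta = e (iter N F x) * (1 - e eta) by ring.
    by rewrite modulusM modulus_expi2pi mul1r.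
  rewrite (modulusB (iter N f (e t2))).
  have -> : iter N f (e x) - iter N f (e t2) = (iter N f (e x) - iter N f z) + (iter N f z - iter N f (e t2)) by ring.
  exact: modulusD.
have [h|h] := leP (chi / 2) (modulus (iter N f (e t2) - iter N f z)); first exact: key h.
apply: (key x); first by rewrite lexx.
lra.
Qed.

End dynamics.

Section blaschke_dynamics.
Context {R : realType}.
Implicit Types (z w xi : R[i]).
Local Notation e := (@expi2pi R).

(** The depth [l / d] is chosen so that dilating by [d] gives back the arc itself: an arc of one
    generation thereby becomes the arc in which the next family is looked for. *)
Definition arc_center (d : nat) (zeta : R[i]) (l : R) : R[i] := zeta * (1 - l / d%:R)%:C%C.

Lemma arc_center_dilated (d : nat) (zeta : R[i]) (l : R) : (0 < d)%N -> modulus zeta = 1 ->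
  0 < l -> l <= 1 -> dilated_arc d%:R (arc_center d zeta l) = closed_arc zeta l.
Proof.
move=> d0 h l0 l1; have dR : 1 <= d%:R :> R by rewrite (ler_nat _ 1).
have dR0 : (d%:R : R) != 0 by lra.
have zeta0 := modulus1_neq0 h.
have ld : l / d%:R <= 1 by rewrite ler_pdivrMr; lra.
have ld1 : 0 <= 1 - l / d%:R by rewrite subr_ge0.
have mE : modulus (arc_center d zeta l) = 1 - l / d%:R.
  by rewrite /arc_center modulusM h mul1r modulus_real.
(* The centre is 0 only if [l = d = 1], and then both sides are the whole circle. *)
rewrite /dilated_arc; case: eqVneq => [z0|z0].
  have h2 : l / d%:R = 1 by move: mE; rewrite z0 modulus0; lra.
  have h3 : l = d%:R by apply: (mulIf (invr_neq0 dR0)); rewrite h2 divff.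
  have [s ->] := expi2pi_surj h.
  by rewrite closed_arc_expi2pi arc_full//; lra.
have dl : d%:R * (1 - modulus (arc_center d zeta l)) = l by rewrite mE; field.
rewrite dl l1 normcE_modulus mE /arc_center mulfK//.
by apply: contra_neq z0 => h0; rewrite /arc_center h0 mulr0.
Qed.

Lemma arc_center_disk (d : nat) (zeta : R[i]) (l : R) : (0 < d)%N -> modulus zeta = 1 ->
  0 < l -> l <= 1 -> modulus (arc_center d zeta l) < 1.
Proof.
move=> d0 h l0 l1; have dR : 1 <= d%:R :> R by rewrite (ler_nat _ 1).
have ld : l / d%:R <= 1 by rewrite ler_pdivrMr; lra.
have ld0 : 0 < l / d%:R by rewrite divr_gt0//; lra.
by rewrite /arc_center modulusM h mul1r modulus_real; lra.
Qed.

Lemma contracting_iter (f : R[i] -> R[i]) (r eps : R) : contracting f -> 0 <= r -> r < 1 ->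
  0 < eps ->
  exists2 Q, (0 < Q)%N & forall z, modulus z <= r -> modulus (iter Q f z) < eps.
Proof.
move=> hc r0 r1 eps0; have [k [k0 k1 hk]] := hc r r0 r1.
have hn n z : modulus z <= r -> modulus (iter n f z) <= k ^+ n.
  move=> zr; suff H : modulus (iter n f z) <= k ^+ n * r.
    by apply: le_trans H _; rewrite ler_piMr ?exprn_ge0// ltW.
  elim: n => [|n IH]; first by rewrite mul1r.
  rewrite iterS exprS -mulrA; apply: le_trans (hk _ _) _; last by rewrite ler_wpM2l.
  by apply: le_trans IH _; rewrite ler_piMl// exprn_ile1// ltW.
have kc : k ^+ n @[n --> \oo] --> (0 : R) by apply: cvg_expr; rewrite ger0_norm.
have /cvgrPdist_lt /(_ _ eps0) [n _ hn2] := kc.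
exists n.+1 => // z zr; apply: le_lt_trans (hn _ _ zr) _.
by have := hn2 n.+1 (leqnSn n); rewrite /= sub0r normrN ger0_norm// exprn_ge0.
Qed.

(** [Q] can be chosen before [N], [zeta] and [l], because [return_bound] yields a radius below 1
    that depends on none of them; [Q] further iterations carry that disk into the disk of radius
    [eps]. *)
Lemma blaschke_dynamics (f : R[i] -> R[i]) (d : nat) (eta eps : R) :
  is_blaschke0 f -> ~ is_rotation f -> (0 < d)%N -> 0 < eta -> eta < 4^-1 -> 0 < eps ->
  exists (lam : R) (Q : nat), [/\ 1 < lam, (0 < Q)%N, 1 < min_deriv f,
    f 0 = 0 /\ (forall xi, modulus xi = 1 -> modulus (f xi) = 1) &
    forall N zeta l, modulus zeta = 1 -> 0 < l -> l <= 1 ->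
      eta <= circle_measure (iter N f @` closed_arc zeta l) ->
      circle_measure (iter N f @` closed_arc zeta l) <= 4 * eta ->
      modulus (iter (N + Q) f (arc_center d zeta l)) < eps /\
      forall n xi xi', (n <= N)%N -> closed_arc zeta l xi -> closed_arc zeta l xi' ->
        modulus (iter n f xi - iter n f xi') <= 16 * lam ^- (N - n)].
Proof.
move=> hb hr d0 eta0 eta4 eps0.
have [b [hf [lam lam1 hlam] hc]] := blaschke_structure hb hr.
have f0 : f 0 = 0.
  have [k [_ _ hk]] := hc 0 (lexx _) ltr01.
  have := hk 0; rewrite modulus0 mulr0 => /(_ (lexx _)) h.
  by apply: modulus_eq0; apply/eqP; rewrite eq_le h modulus_ge0.
have diskf z : modulus z < 1 -> modulus (f z) < 1.
  move=> z1; have [k [k0 k1 hk]] := hc _ (modulus_ge0 z) z1.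
  apply: le_lt_trans (hk z (lexx _)) _; apply: le_lt_trans z1.
  by rewrite ler_piMl ?modulus_ge0// ltW.
have [F hF] := inner_lift hf.
have [K K0 hK] := inner_lipschitz hf.
have L0 : 0 <= K * 16 by rewrite mulr_ge0.
have lipb s t : `|b (e s) - b (e t)| <= K * 16 * `|s - t|.
  apply: le_trans (hK _ _ (modulus_expi2pi s) (modulus_expi2pi t)) _.
  by rewrite -mulrA ler_wpM2l// expi2pi_lipschitz.
set D := 324 * d%:R * expR (K * 16 / (lam - 1)).
have D0 : 0 < D.
  by apply: mulr_gt0; [apply: mulr_gt0; rewrite ltr0n|exact: expR_gt0].
have chi0 : 0 < modulus (1 - e eta).
  apply: modulus_gt0; rewrite subr_eq0 eq_sym; apply/eqP => /expi2pi_eq1 [k hk].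
  have k0 : (0 < k)%R by rewrite -(ltr_int R) -hk.
  have k1 : (k < 1)%R by rewrite -(ltr_int R) -hk; lra.
  lia.
set r := Num.sqrt (1 - modulus (1 - e eta) ^+ 2 / D).
have r1 : r < 1.
  by rewrite -[ltRHS]sqrtr1 ltr_sqrt// gtrDl oppr_lt0 divr_gt0 ?exprn_gt0.
have [Q Q0 hQ] := contracting_iter hc (sqrtr_ge0 _) r1 eps0.
exists lam, Q; split=> //; [exact: min_deriv_gt1 hf lam1 hlam|by split=> //;
  exact: (inner_circle hf)|].
move=> N zeta l hz l0 l1 m1 m2.
have [s zE] := expi2pi_surj hz; rewrite zE in m1 m2 *; split.
  rewrite addnC iterD; apply: hQ.
  exact: (return_bound hf lam1 hlam (fun t => proj1 (hF t)) (fun t => proj2 (hF t)) L0 lipb diskf).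
move=> n xi xi' nN; rewrite closed_arc_expi2pi in m2 *.
apply: (arc_oscillation lam1 hlam (fun t => proj1 (hF t)) (fun t => proj2 (hF t))) => //; first lra.
by apply: le_lt_trans m2 _; lra.
Qed.

End blaschke_dynamics.

(** * Steering towards a prescribed sum *)

Section real_sequences.
Context {R : realType}.

(* The potential [x k - g * B k] absorbs the term [g * B k.+1]. *)
Lemma drift_cvg0 (x B : nat -> R) (c g : R) :
  0 <= g -> 2 * g < c -> (forall k, 0 <= x k) -> (forall k, 0 <= B k) ->
  B k @[k --> \oo] --> 0 ->
  (forall A, exists n, A < \sum_(0 <= k < n) B k) ->
  (forall d, 0 < d -> \forall k \near \oo, d <= x k ->
    x k.+1 <= x k - c * B k + g * (B k + B k.+1)) ->
  (forall k, x k.+1 <= x k + B k + g * (B k + B k.+1)) ->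
  x k @[k --> \oo] --> 0.
Proof.
move=> g0 gc x0 B0 /cvgrPdist_lt Bc Bdiv drift step.
apply/cvgrPdist_lt => eps eps0.
(* The final bound is [3 * d]: at most [2 * d] for the potential [p] and [d] for the term
   [g * B k]. *)
pose d := eps / 4; have d0 : 0 < d by rewrite divr_gt0.
pose b := d / (1 + 2 * g); have b0 : 0 < b by rewrite divr_gt0//; lra.
have [n1 _ h1] := Bc b b0; have [n2 _ h2] := drift d d0.
pose m := maxn n1 n2.
have Bm k : (m <= k)%N -> B k < b.
  by move=> mk; have := h1 k (leq_trans (leq_maxl _ _) mk); rewrite /= sub0r normrN ger0_norm.
have dm k : (m <= k)%N -> d <= x k -> x k.+1 <= x k - c * B k + g * (B k + B k.+1).
  by move=> mk; exact: (h2 k (leq_trans (leq_maxr _ _) mk)).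
have bd : (1 + 2 * g) * b = d by rewrite /b mulrC divfK//; lra.
have small k : (m <= k)%N -> (1 + 2 * g) * B k <= d.
  by move=> mk; rewrite -bd ler_wpM2l ?ltW ?Bm//; lra.
have gB k : (m <= k)%N -> 0 <= g * B k <= d.
  move=> mk; have := small k mk; have := B0 k; have := mulr_ge0 g0 (B0 k) => *.
  by apply/andP; split; lra.
pose p k := x k - g * B k.
(* If [x] stayed above [d], each step would lower [p] by at least [(c - 2 * g) * B k]; the divergent
   sum would push it below [- d], its lower bound. *)
have [k2 mk2 xk2] : exists2 k, (m <= k)%N & x k < d.
  apply: contrapT => /forall2NP hn.
  have big k : (m <= k)%N -> d <= x k by move=> mk; rewrite leNgt; apply/negP; case: (hn k).
  have dec j : p (m + j)%N <= p m - (c - 2 * g) * \sum_(m <= k < m + j) B k.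
    elim: j => [|j IH]; first by rewrite addn0 big_geq// mulr0 subr0.
    rewrite addnS big_nat_recr ?leq_addr//= mulrDr.
    have := dm (m + j)%N (leq_addr _ _) (big _ (leq_addr _ _)); move: IH; rewrite /p.
    by lra.
  have [n hn2] := Bdiv (\sum_(0 <= k < m) B k + (p m + d) / (c - 2 * g)).
  have cg : 0 < c - 2 * g by lra.
  have mn : (m <= n)%N.
    rewrite leqNgt; apply/negP => nm.
    have : \sum_(0 <= k < n) B k <= \sum_(0 <= k < m) B k.
      by rewrite (big_cat_nat (n := n) (p := m))//= ?lerDl ?sumr_ge0// ltnW.
    have : 0 <= (p m + d) / (c - 2 * g).
      apply: divr_ge0; last exact: ltW.
      by rewrite /p; have /andP[_] := gB m (leqnn _); have := x0 m; lra.
    lra.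
  have hs : \sum_(0 <= k < n) B k = \sum_(0 <= k < m) B k + \sum_(m <= k < n) B k.
    exact: big_cat_nat.
  rewrite hs ltrD2l ltr_pdivrMr// in hn2.
  have := dec (n - m)%N; rewrite subnKC// => hd.
  have := gB n mn; have := x0 n; rewrite {1}/p in hd; lra.
(* Above [d] the potential does not increase; below [d] a single step cannot carry it beyond
   [2 * d]. *)
have pk j : p (k2 + j)%N <= 2 * d.
  elim: j => [|j IH]; first by rewrite addn0 /p; have := gB k2 mk2; lra.
  have mkj : (m <= k2 + j)%N by apply: leq_trans mk2 (leq_addr _ _).
  rewrite addnS /p; have [h|h] := leP d (x (k2 + j)%N).
    have := dm _ mkj h; move: IH; rewrite /p.
    have : 0 <= (c - 2 * g) * B (k2 + j)%N by rewrite mulr_ge0//; lra.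
    lra.
  have := step (k2 + j)%N; have := small _ mkj; have := gB _ mkj; lra.
exists k2 => // k /= k2k; rewrite sub0r normrN ger0_norm//.
have := pk (k - k2)%N; rewrite subnKC// /p.
have := gB k (leq_trans mk2 k2k); rewrite /d; lra.
Qed.

Lemma geometric_average_cvg0 (lam : R) (u y : nat -> R) : 1 < lam -> (forall n, 0 <= y n) ->
  (forall n, y n.+1 <= (y n + u n) / lam) -> u n @[n --> \oo] --> 0 -> y n @[n --> \oo] --> 0.
Proof.
move=> lam1 y0 hy /cvgrPdist_lt uc; apply/cvgrPdist_lt => eps eps0.
have l0 : 0 < lam by lra.
(* Chosen so that [eps / 2] is the fixed point of the map sending [y] to [(y + d) / lam]. *)
pose d := eps / 2 * (lam - 1); have d0 : 0 < d by rewrite mulr_gt0; lra.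
have [m _ hm] := uc d d0.
have um k : (m <= k)%N -> u k <= d.
  by move=> mk; have := hm k mk; rewrite /= sub0r normrN => h; apply: le_trans (ler_norm _) (ltW h).
have geo j : y (m + j)%N <= eps / 2 + y m * (lam^-1) ^+ j.
  elim: j => [|j IH]; first by rewrite addn0 expr0 mulr1; lra.
  rewrite addnS; apply: le_trans (hy _) _.
  rewrite ler_pdivrMr// exprSr mulrDl mulrA mulfVK ?lt0r_neq0//.
  have := um (m + j)%N (leq_addr _ _); move: IH; rewrite /d; lra.
have c0 : y m * (lam^-1) ^+ j @[j --> \oo] --> 0.
  rewrite -(mulr0 (y m)); apply: cvgMr; apply: cvg_expr.
  by rewrite ger0_norm ?invr_ge0 ?ltW// invf_lt1.
move/cvgrPdist_lt : c0 => /(_ (eps / 2)) [|j0 _ hj]; first by rewrite divr_gt0.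
exists (m + j0)%N => // k /= mk; rewrite sub0r normrN ger0_norm//.
have e : k = (m + (k - m))%N by lia.
have := geo (k - m)%N; rewrite -e.
have := hj (k - m)%N; rewrite /= => /(_ _).
have -> : (j0 <= k - m)%N by lia.
move=> /(_ isT); rewrite sub0r normrN ger0_norm; first lra.
by rewrite mulr_ge0// exprn_ge0// invr_ge0 ltW.
Qed.

(** Here [v] is the remainder at the limit point, [V] the one at the reference point, [u] the
    direction of [V] and [b] the block. Expanding [|v - b|^2] gives a gain [2 * gam * B * |v|]
    against errors [4 * o * B + B ^+ 2]; the assumption on [d] lets the errors eat at most half of
    the gain, whence [gam / 2]. *)
Lemma steering_step (v V b u : R[i]) (o B gam d : R) :
  modulus (v - V) <= o -> modulus b <= B -> V = (modulus V)%:C%C * u ->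
  gam * B <= complex.Re (u^*%C * b) -> 0 <= gam -> gam <= 1 -> d <= modulus v ->
    4 * o + B <= gam * d ->
  modulus (v - b) <= modulus v - gam / 2 * B.
Proof.
move=> vV bB VE hb g0 g1 dv hd.
have B0 : 0 <= B by apply: le_trans bB; exact: modulus_ge0.
have o0 : 0 <= o by apply: le_trans vV; exact: modulus_ge0.
have V0 := modulus_ge0 V.
have h1 : modulus v - o <= modulus V by have := modulus_le_add v V; lra.
have r1 : complex.Re (V^*%C * b) = modulus V * complex.Re (u^*%C * b).
  rewrite {1}VE; case: u {VE hb} => p q; case: b {bB} => r s /=; ring.
have r2 : - (o * B) <= complex.Re ((v - V)^*%C * b).
  have := modulus_Re (- ((v - V)^*%C * b)); rewrite modulusN modulusM modulusJ raddfN/=.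
  have : modulus (v - V) * modulus b <= o * B by apply: ler_pM; rewrite ?modulus_ge0.
  lra.
have r3 : modulus v * (gam * B) - 2 * (o * B) <= complex.Re (v^*%C * b).
  have -> : complex.Re (v^*%C * b) = complex.Re (V^*%C * b) + complex.Re ((v - V)^*%C * b).
    by rewrite -raddfD/= -mulrDl -rmorphD/= addrC subrK.
  rewrite r1.
  have s1 : modulus V * (gam * B) <= modulus V * complex.Re (u^*%C * b) by rewrite ler_wpM2l.
  have gB0 : 0 <= gam * B by rewrite mulr_ge0.
  have s2 : (modulus v - o) * (gam * B) <= modulus V * (gam * B) by rewrite ler_wpM2r.
  have s3 : o * (gam * B) <= o * B by rewrite ler_wpM2l// ler_piMl.
  lra.
have e : modulus (v - b) ^+ 2 = modulus v ^+ 2 - 2 * complex.Re (v^*%C * b) + modulus b ^+ 2.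
  by rewrite !modulus_sqr; case: (v) => p q; case: (b) => r s /=; ring.
have v0 := modulus_ge0 v.
have gd : gam * d <= gam * modulus v by rewrite ler_wpM2l.
have pos : 0 <= modulus v - gam / 2 * B.
  have : gam * modulus v <= modulus v by rewrite ler_piMl.
  have : gam * B <= B by rewrite ler_piMl.
  lra.
rewrite -(ler_pXn2r (n:=2)) ?nnegrE ?modulus_ge0// e.
have b2 : modulus b ^+ 2 <= B ^+ 2 by rewrite ler_pXn2r ?nnegrE ?modulus_ge0.
have fin : B * (4 * o + B) <= B * (gam * modulus v) by rewrite ler_wpM2l//; lra.
have sq := sqr_ge0 (gam / 2 * B).
have -> : (modulus v - gam / 2 * B) ^+ 2 = modulus v ^+ 2 - B * (gam * modulus v) + (gam / 2 * B) ^+ 2 by field.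
have : B * (4 * o + B) = 4 * (o * B) + B ^+ 2 by ring.
have : modulus v * (gam * B) = B * (gam * modulus v) by ring.
lra.
Qed.

End real_sequences.

(** * Sums of nonnegative terms and the choice of the blocks *)

Section nonneg_sums.
Context {R : realType}.
Variable u : nat -> R.
Hypothesis u0 : forall n, 0 <= u n.
Local Notation S m p := (\sum_(m <= n < p) u n).

Lemma sum_ge0 m p : 0 <= S m p.
Proof. exact: sumr_ge0. Qed.

Lemma le_sum_sub m m' p p' : (m' <= m)%N -> (p <= p')%N -> S m p <= S m' p'.
Proof.
move=> mm pp; have [mp|pm] := leqP m p; last first.
  by rewrite big_geq ?sum_ge0// ltnW.
rewrite (big_cat_nat mm (leq_trans mp pp))/= (big_cat_nat mp pp)/=.
have := sum_ge0 m' m; have := sum_ge0 p p'; lra.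
Qed.

Lemma sum_sqr_le m p : S m p ^+ 2 <= (p - m)%:R * \sum_(m <= n < p) u n ^+ 2.
Proof.
have [mp|pm] := leqP m p; last by rewrite !big_geq ?mulr0 ?expr0n// ltnW.
rewrite -(subnKC mp); move: (p - m)%N => j; rewrite addKn.
have cross i a : 2 * (\sum_(m <= n < m + i) u n * a) <= \sum_(m <= n < m + i) u n ^+ 2 + i%:R * a ^+ 2.
  elim: i => [|i IH]; first by rewrite addn0 !big_geq// mulr0 mul0r addr0.
  rewrite addnS !big_nat_recr ?leq_addr//= -natr1.
  have := sqr_ge0 (u (m + i)%N - a); move: IH.
  set A := \sum_(_ <= _ < _) _; set A2 := \sum_(_ <= _ < _) _; nra.
elim: j => [|j IH]; first by rewrite addn0 !big_geq// mulr0 expr0n.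
rewrite addnS !big_nat_recr ?leq_addr//= -natr1.
have := cross j (u (m + j)%N); rewrite -mulr_suml; move: IH.
set A := \sum_(_ <= _ < _) _; set A2 := \sum_(_ <= _ < _) _; nra.
Qed.

Lemma window_pigeonhole m N Q : (0 < N)%N -> exists2 q, (q < N)%N &
  N%:R * S (m + q * Q) (m + q * Q + Q) <= S m (m + N * Q).
Proof.
move=> N0; apply: contrapT => /forall2NP hn.
have big q : (q < N)%N -> S m (m + N * Q) < N%:R * S (m + q * Q) (m + q * Q + Q).
  by move=> qN; rewrite ltNge; apply/negP; case: (hn q).
have split_sum j : S m (m + j * Q) = \sum_(0 <= q < j) S (m + q * Q) (m + q * Q + Q).
  elim: j => [|j IH]; first by rewrite mul0n addn0 !big_geq.
  rewrite big_nat_recr//= -IH -big_cat_nat ?leq_addr//=.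
  by rewrite mulSn (addnC Q) addnA.
have : \sum_(0 <= q < N) S m (m + N * Q) < \sum_(0 <= q < N) (N%:R * S (m + q * Q) (m + q * Q + Q)).
  apply: ltr_sum_nat => // q /andP[_ qN]; exact: big.
rewrite -mulr_sumr -split_sum sumr_const_nat subn0 mulr_natl ltxx//.
Qed.

End nonneg_sums.

Section schedule.
Context {R : realType}.
Variable u : nat -> R.
Hypothesis u0 : forall n, 0 <= u n.
Local Notation S m p := (\sum_(m <= n < p) u n).
Variables (Mb Nb : nat -> nat) (N Q : nat) (beta : R).
Hypothesis N2 : (2 <= N)%N.
Hypothesis Q0 : (0 < Q)%N.
Hypothesis Mb0 : Mb 0 = 1%N.
Hypothesis MbS : forall k, Mb k.+1 = (Nb k + N * Q)%N.
Hypothesis MN : forall k, (Mb k < Nb k)%N.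
Hypothesis ucvg : u n @[n --> \oo] --> 0.
Hypothesis Lcvg : S (Mb k) (Nb k) @[k --> \oo] --> 0.
Hypothesis udiv : forall A, exists m, A < S 1 m.
Hypothesis beta0 : 0 < beta.
Hypothesis hbeta : forall k, beta * S (Mb k) (Nb k) <= Num.sqrt (\sum_(Mb k <= n < Nb k) u n ^+ 2).

(* Ratio between the [l^2] and [l^1] norms of [u], on the long part of a block by
   [hbeta] and on its two short ends by the Cauchy-Schwarz inequality. *)
Definition mu_rate : R := Num.min beta (Num.sqrt (N%:R * Q%:R + 1))^-1.

Let K0 : 0 < N%:R * Q%:R + 1 :> R.
Proof. by rewrite ltr_wpDl// mulr_ge0. Qed.

Lemma mu_rate_gt0 : 0 < mu_rate.
Proof. by rewrite /mu_rate lt_min beta0/= invr_gt0 sqrtr_gt0. Qed.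

(** Meant for the two ends added to a block. The [+ 1] in the length is there because a block
    includes its last index. *)
Lemma short_sum_sqrt m p : (p - m <= N * Q + 1)%N ->
  mu_rate * S m p <= Num.sqrt (\sum_(m <= n < p) u n ^+ 2).
Proof.
move=> h; apply: (@le_trans _ _ ((Num.sqrt (N%:R * Q%:R + 1))^-1 * S m p)).
  by rewrite ler_wpM2r ?sum_ge0// ge_min lexx orbT.
rewrite mulrC ler_pdivrMr ?sqrtr_gt0// mulrC -sqrtrM; last exact: ltW.
rewrite -(ger0_norm (sum_ge0 u0 m p)) -sqrtr_sqr ler_wsqrtr//.
apply: le_trans (sum_sqr_le u m p) _; rewrite ler_wpM2r ?sumr_ge0// => [n _|]; first exact: sqr_ge0.
by rewrite -natrM natr1 ler_nat; lia.
Qed.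

(** Cauchy-Schwarz for three summands; this is where the square root of 3 in the numerical
    conditions originates. *)
Lemma sqrt_sum3_ge (X Y Z A B C mu : R) : 0 <= X -> 0 <= Y -> 0 <= Z -> 0 <= A -> 0 <= B ->
  0 <= C -> 0 < mu ->
  mu * X <= Num.sqrt A -> mu * Y <= Num.sqrt B -> mu * Z <= Num.sqrt C ->
  mu / Num.sqrt 3 * (X + Y + Z) <= Num.sqrt (A + B + C).
Proof.
move=> X0 Y0 Z0 A0 B0 C0 mu0 h1 h2 h3.
have sq (T D : R) : 0 <= T -> 0 <= D -> mu * T <= Num.sqrt D -> (mu * T) ^+ 2 <= D.
  move=> T0 D0 h; rewrite -(sqr_sqrtr D0) ler_pXn2r ?nnegrE ?sqrtr_ge0//.
  by rewrite mulr_ge0// ltW.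
have := sq _ _ X0 A0 h1; have := sq _ _ Y0 B0 h2; have := sq _ _ Z0 C0 h3 => s1 s2 s3.
rewrite mulrAC ler_pdivrMr ?sqrtr_gt0// -sqrtrM ?addr_ge0//.
have P0 : 0 <= mu * (X + Y + Z) by rewrite mulr_ge0 ?addr_ge0// ltW.
rewrite -(ger0_norm P0) -sqrtr_sqr ler_wsqrtr//.
have := sqr_ge0 (mu * X - mu * Y); have := sqr_ge0 (mu * X - mu * Z); have :=
  sqr_ge0 (mu * Y - mu * Z).
rewrite mulrDr mulrDr; move: s1 s2 s3; move: (mu * X) (mu * Y) (mu * Z) => x y z; nra.
Qed.

Lemma Nb_ge k : (k < Nb k)%N.
Proof. elim: k => [|k IH]; first exact: leq_ltn_trans (MN 0); have := MN k.+1; rewrite MbS;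
  nia. Qed.

Lemma window_cvg : S (Nb k) (Nb k + N * Q) @[k --> \oo] --> 0.
Proof.
apply/cvgrPdist_lt => eps eps0.
have d0 : 0 < eps / (N%:R * Q%:R + 1) by rewrite divr_gt0.
move/cvgrPdist_lt : ucvg => /(_ _ d0) [m _ hm].
exists m => // k /= mk; rewrite sub0r normrN ger0_norm ?sum_ge0//.
apply: (@le_lt_trans _ _ (\sum_(Nb k <= n < Nb k + N * Q) eps / (N%:R * Q%:R + 1))).
  rewrite !big_nat; apply: ler_sum => n /andP[h1 h2].
  have := hm n; rewrite /= sub0r normrN ger0_norm// => h; apply/ltW/h.
  by have := Nb_ge k; lia.
have -> : \sum_(Nb k <= n < Nb k + N * Q) eps / (N%:R * Q%:R + 1) = N%:R * Q%:R * (eps / (N%:R * Q%:R + 1)).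
  by rewrite sumr_const_nat addKn -natrM mulr_natl.
by rewrite mulrA ltr_pdivrMr// mulrC ltr_pM2l//; lra.
Qed.

(* The indices of the paper start at 1; here [Mb k] and [Nb k] stand for the bars
   of index [k.+1].  Block [k] is [M k .. Nn k], both ends included. *)
Lemma schedule : exists M Nn : nat -> nat,
  [/\ M 0 = 1%N, forall k, (M k < Nn k)%N, forall k, M k.+1 = (Nn k + Q)%N &
      forall k, (M k <= Mb k)%N /\ (Nb k <= Nn k)%N] /\
  [/\ forall k, (N%:R - 1) * S (Nn k).+1 (M k.+1) <= S (M k) (Nn k).+1 + S (M k.+1) (Nn k.+1).+1,
      S (M k) (Nn k).+1 @[k --> \oo] --> 0,
      forall A, exists n, A < \sum_(0 <= k < n) S (M k) (Nn k).+1 &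
      forall k, mu_rate / Num.sqrt 3 * S (M k) (Nn k).+1 <= Num.sqrt (\sum_(M k <= n < (Nn k).+1) u n ^+ 2)].
Proof.
have N0 : (0 < N)%N by lia.
have /choice [q hq] : forall k, exists q, (q < N)%N /\
    N%:R * S (Nb k + q * Q) (Nb k + q * Q + Q) <= S (Nb k) (Nb k + N * Q).
  by move=> k; have [q h1 h2] := window_pigeonhole u (Nb k) Q N0; exists q.
(* The block is prolonged up to the cheapest window of length [Q], so that precisely this window
   separates it from the next block. *)
pose Nn k := (Nb k + q k * Q)%N.
pose M k := if k is k'.+1 then (Nn k' + Q)%N else 1%N.
have qQ k : (q k * Q + Q <= N * Q)%N.
  by have [h _] := hq k; rewrite -mulSnr leq_mul2r h orbT.
have MMb k : (M k <= Mb k)%N.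
  by case: k => [|k]; rewrite ?Mb0//= MbS /Nn -addnA leq_add2l.
have NbNn k : (Nb k <= Nn k)%N by rewrite leq_addr.
have MNn k : (M k < Nn k)%N by apply: leq_ltn_trans (MMb k) (leq_trans (MN k) (NbNn k)).
have N1 : 1 <= N%:R - 1 :> R.
  by have : 2 <= N%:R :> R; [rewrite (ler_nat _ 2)|lra].
(* Removing the chosen window from the [N] windows leaves [N - 1] on the left, while all the others
   lie inside the block before or the block after. *)
have Tk k : (N%:R - 1) * S (Nn k).+1 (M k.+1) <= S (M k) (Nn k).+1 + S (M k.+1) (Nn k.+1).+1.
  have [_ h] := hq k; rewrite -/(Nn k) in h.
  have e : S (Nb k) (Nb k + N * Q) = S (Nb k) (Nn k) + S (Nn k) (Nn k + Q) + S (Nn k + Q) (Nb k + N * Q).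
    rewrite -(big_cat_nat (n := Nn k))/= ?leq_addr//.
    by rewrite -(big_cat_nat (n := (Nn k + Q)%N))//= /Nn -?addnA ?leq_addr ?leq_add2l.
  have a1 : S (Nb k) (Nn k) <= S (M k) (Nn k).+1.
    apply: le_sum_sub => //; apply: leq_trans (MMb k) (ltnW (MN k)).
  have a2 : S (Nn k + Q) (Nb k + N * Q) <= S (M k.+1) (Nn k.+1).+1.
    apply: le_sum_sub => //; rewrite -MbS; apply: leq_trans (ltnW (MN k.+1)) _.
    exact: leq_trans (NbNn _) (leqnSn _).
  have a3 : (N%:R - 1) * S (Nn k).+1 (M k.+1) <= (N%:R - 1) * S (Nn k) (Nn k + Q).
    by rewrite ler_wpM2l; [|lra|exact: le_sum_sub].
  apply: le_trans a3 _; rewrite mulrBl mul1r; lra.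
exists M, Nn; do 2 split => //.
- have bound k : S (M k.+1) (Nn k.+1).+1 <= S (Nb k) (Nb k + N * Q) + S (Mb k.+1) (Nb k.+1)
      + S (Nb k.+1) (Nb k.+1 + N * Q).
    rewrite -MbS -(big_cat_nat (n := Mb k.+1))/=; [|by rewrite MbS leq_addr|exact: ltnW].
    rewrite -(big_cat_nat (n := Nb k.+1))/=;
      [|by rewrite (leq_trans _ (ltnW (MN _)))// MbS leq_addr|by rewrite leq_addr].
    apply: le_sum_sub => //; first by rewrite /M /Nn -addnA leq_addr.
    by have := qQ k.+1; rewrite /Nn; lia.
  suff H : S (M k.+1) (Nn k.+1).+1 @[k --> \oo] --> 0 by rewrite (cvg_shiftS (fun k => S (M k) (Nn k).+1)) in H.
  pose h k := S (Nb k) (Nb k + N * Q) + S (Mb k.+1) (Nb k.+1) + S (Nb k.+1) (Nb k.+1 + N * Q).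
  apply: (@squeeze_cvgr _ _ _ _ (fun=> 0) h).
  + by apply: nearW => k; rewrite sum_ge0//=; exact: bound.
  + exact: cvg_cst.
  + have H : h k @[k --> \oo] --> (0 + 0 + 0 : R).
      apply: cvgD; first (apply: cvgD; first exact: window_cvg).
        by have := Lcvg; rewrite -(cvg_shiftS (fun k => S (Mb k) (Nb k))).
      by have := window_cvg; rewrite -(cvg_shiftS (fun k => S (Nb k) (Nb k + N * Q))).
    by rewrite !addr0 in H.
- move=> A; have [m hm] := udiv (3 * A).
  (* Since [1 <= N - 1], a gap costs no more than its two neighbours. A block thus pays for itself
     and for one gap on each side, which explains the 3 in [3 * A]. *)
  have tele j : S 1 (M j) <= 2 * \sum_(0 <= k < j) S (M k) (Nn k).+1 + \sum_(0 <= k < j.+1) S (M k) (Nn k).+1.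
    elim: j => [|j IH].
      rewrite [leLHS]big_geq// [X in 2 * X]big_geq// mulr0 add0r.
      by apply: sumr_ge0 => k _; exact: sum_ge0.
    rewrite [X in 2 * X]big_nat_recr//= [X in _ <= _ + X]big_nat_recr//=.
    have M1 : (1 <= M j)%N by case: (j) => //= k; rewrite ltn_addl.
    have e : S 1 (Nn j + Q) = S 1 (M j) + S (M j) (Nn j).+1 + S (Nn j).+1 (M j.+1).
      rewrite -(big_cat_nat (n := M j))//=; last by have := MNn j; lia.
      by rewrite -(big_cat_nat (n := (Nn j).+1))//=; have := MNn j; lia.
    rewrite e; have := Tk j; have t0 := sum_ge0 u0 (Nn j).+1 (M j.+1).
    have : S (Nn j).+1 (M j.+1) <= (N%:R - 1) * S (Nn j).+1 (M j.+1) by rewrite ler_peMl.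
    move: IH; lra.
  exists m.+1; have := tele m.
  have mM j : (j < M j)%N.
    by elim: j => //= j IH; have := MNn j; lia.
  have c1 : S 1 m <= S 1 (M m) by apply: le_sum_sub => //; exact: ltnW.
  have c2 : \sum_(0 <= k < m) S (M k) (Nn k).+1 <= \sum_(0 <= k < m.+1) S (M k) (Nn k).+1.
    by rewrite big_nat_recr//= lerDl sum_ge0.
  lra.
- move=> k; have h1 := MMb k; have h2 := MN k; have h3 := NbNn k.
  have e (v : nat -> R) : \sum_(M k <= n < (Nn k).+1) v n =
      \sum_(M k <= n < Mb k) v n + \sum_(Mb k <= n < Nb k) v n + \sum_(Nb k <= n < (Nn k).+1) v n.
    by rewrite -!big_cat_nat//=; lia.
  rewrite !e; apply: sqrt_sum3_ge; rewrite ?sum_ge0 ?sumr_ge0//; try by move=> *; exact: sqr_ge0.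
  + exact: mu_rate_gt0.
  + apply: short_sum_sqrt; case: (k) => [|j]; first by rewrite /M Mb0.
    by rewrite MbS /M /Nn; lia.
  + apply: le_trans (hbeta k); rewrite ler_wpM2r ?sum_ge0// ge_min lexx//.
  + by apply: short_sum_sqrt; rewrite /Nn; have := qQ k; lia.
Qed.

End schedule.

(** * Scales of the measure function *)

Section scales.
Context {R : realType}.
Variables (phi : R -> R) (f : R[i] -> R[i]) (B : @arc_constants R).
Hypothesis psi_decr : forall s t : R, 0 < s -> s <= t -> psi phi t <= psi phi s.
Hypothesis psi_infty : psi phi t @[t --> 0^'+] --> +oo.
Hypothesis C0 : 0 < C_star B.
Hypothesis C1 : C_star B < 1.
Local Notation C := (C_star B).
Local Notation I v := (psi_inv phi v).

Lemma psi_gt v : exists2 s, 0 < s & v < psi phi s.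
Proof.
have /(cvgryPgt _) /(_ v) H := psi_infty.
have [e e0 he] : \forall s \near 0^'+, 0 < s /\ v < psi phi s.
  by near=> s; split; near: s; [exact: nbhs_right_gt|].
have e2 : 0 < e / 2 by rewrite divr_gt0.
have [] := he (e / 2) _ e2; last by move=> _ h; exists (e / 2).
rewrite /ball/= sub0r normrN ger0_norm ?ltW//.
have : 0 < e by []. lra.
Unshelve. all: by end_near. Qed.

Lemma psi_inv_gt0 v : (0 < I v)%E.
Proof.
have [s s0 vs] := psi_gt v; apply: (@lt_le_trans _ _ s%:E); first by rewrite lte_fin.
by apply: ereal_sup_ubound; exists s.
Qed.

Lemma psi_inv_le v s : 0 < s -> psi phi s <= v -> (I v <= s%:E)%E.
Proof.
move=> s0 h; apply: ge_ereal_sup => _ [r /= [r0 vr] <-]; rewrite lee_fin leNgt; apply/negP => sr.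
by have := psi_decr s0 (ltW sr); lra.
Qed.

Lemma psi_inv_lt v t : 0 < t -> (t%:E < I v)%E -> v < psi phi t.
Proof.
move=> t0 /ereal_sup_gt [_ [r /= [r0 vr] <-]]; rewrite lte_fin => tr.
by apply: lt_le_trans vr _; apply: psi_decr => //; exact: ltW.
Qed.

Lemma psi_inv_antitone u v : v <= u -> (I u <= I v)%E.
Proof.
move=> vu; apply: le_ereal_sup => _ [r /= [r0 vr] <-]; exists r => //.
by split=> //; exact: le_lt_trans vr.
Qed.

Lemma psi_inv_fin v u : v <= u -> I v != +oo%E -> I u \is a fin_num.
Proof.
move=> vu hv; rewrite ge0_fin_numE ?ltW ?psi_inv_gt0//.
by apply: le_lt_trans (psi_inv_antitone vu) _; rewrite ltey.
Qed.

Lemma fine_psi_inv_gt0 v : I v \is a fin_num -> 0 < fine (I v).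
Proof. by move=> h; rewrite -lte_fin fineK// psi_inv_gt0. Qed.

Lemma C_star_exp_le k l : (k <= l)%N -> C ^- k <= C ^- l.
Proof.
by move=> kl; rewrite lef_pV2 ?posrE ?exprn_gt0//; apply: ler_wiXn2l => //; exact: ltW.
Qed.

Lemma eps_seq_gt0 k : 0 < eps_seq phi B k.
Proof.
rewrite /eps_seq mulr_gt0 ?invr_gt0// lt_min C0/= /psi_inv_ratio.
case: eqP => // /eqP h; rewrite divr_gt0// fine_psi_inv_gt0//; apply: (psi_inv_fin _ h) => //.
exact: C_star_exp_le.
Qed.

Lemma eps_seq_le_ratio k : I (C ^- k) != +oo%E ->
  eps_seq phi B k <= fine (I (C ^- k.+1)) / fine (I (C ^- k)).
Proof.
move=> h; rewrite /eps_seq /psi_inv_ratio (negbTE h).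
set x := _ / _; have x0 : 0 <= x.
  by rewrite divr_ge0// ltW// fine_psi_inv_gt0//; apply: (psi_inv_fin _ h) => //;
    exact: C_star_exp_le.
apply: (@le_trans _ _ (4^-1 * x)); first by rewrite ler_wpM2l// ge_min lexx orbT.
lra.
Qed.

Lemma C_star_exp_large (v : R) : exists k, v <= C ^- k.
Proof.
have c : C ^+ k @[k --> \oo] --> 0 by apply: cvg_expr; rewrite ger0_norm// ltW.
pose w := Num.max v 1; have w0 : 0 < w by rewrite lt_max ltr01 orbT.
have wi : 0 < w^-1 by rewrite invr_gt0.
move/cvgrPdist_lt : c => /(_ _ wi) [k _ hk]; exists k.
have := hk k (leqnn k); rewrite /= sub0r normrN ger0_norm ?exprn_ge0 ?(ltW C0)// => h.
apply: (@le_trans _ _ w); first by rewrite le_max lexx.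
by rewrite -[w]invrK lef_pV2 ?posrE ?exprn_gt0// ltW.
Qed.

(** The index [k] is the scale of [t]: [t] lies between the values of [psi_inv] at [C ^- k.+1] and
    [C ^- k]. The upper end gives the bound by [phi t]. For the lengths, the ratios in [eps_seq]
    telescope and compare [l k] with the lower end; [A] is fixed by the starting bound
    [l k0 <= 1]. *)
Lemma arc_length_scale : exists (A t0 : R), [/\ 0 < A, 0 < t0 & forall t, 0 < t -> t < t0 ->
  exists k, C ^- k * t <= phi t /\
    forall l : nat -> R, l 0%N <= 1 -> (forall k, 0 <= l k) ->
      (forall k, l k.+1 <= eps_seq phi B k.+1 * l k) -> l k <= A * t].
Proof.
(* For small [k] the value of [psi_inv] at [C ^- k] may be infinite; from [k0] on it is at most
   1. *)
have [k0 hk0] := C_star_exp_large (psi phi 1).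
have fin k : (k0 <= k)%N -> I (C ^- k) \is a fin_num.
  move=> kk; rewrite ge0_fin_numE ?ltW ?psi_inv_gt0//.
  apply: (@le_lt_trans _ _ 1%:E); last exact: ltry.
  by apply: psi_inv_le => //; apply: le_trans hk0 (C_star_exp_le kk).
pose s k := fine (I (C ^- k)).
have s0 k : (k0 <= k)%N -> 0 < s k by move=> kk; rewrite fine_psi_inv_gt0 ?fin.
have sE k : (k0 <= k)%N -> I (C ^- k) = (s k)%:E by move=> kk; rewrite fineK ?fin.
have leng (l : nat -> R) : l 0%N <= 1 -> (forall k, 0 <= l k) ->
      (forall k, l k.+1 <= eps_seq phi B k.+1 * l k) -> forall j,
        l (k0 + j)%N <= (s k0.+1)^-1 * s (k0 + j).+1.
  move=> l0 lpos hl j.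
  have le1 k : l k <= 1.
    elim: k => // k IH; apply: le_trans (hl k) _; apply: mulr_ile1 => //;
      first exact: ltW (eps_seq_gt0 _).
    rewrite /eps_seq; apply: (@le_trans _ _ (4^-1 * C)); last by move: (C) C0 C1 => c c0 c1; lra.
    by rewrite ler_wpM2l// ge_min lexx.
  elim: j => [|j IH]; first by rewrite addn0 mulVf ?lt0r_neq0 ?s0.
  rewrite addnS; apply: le_trans (hl _) _.
  have kj : (k0 <= (k0 + j).+1)%N by rewrite -addnS leq_addr.
  have h : eps_seq phi B (k0 + j).+1 <= s (k0 + j).+2 / s (k0 + j).+1.
    by apply: eps_seq_le_ratio; rewrite sE.
  apply: (@le_trans _ _ (s (k0 + j).+2 / s (k0 + j).+1 * ((s k0.+1)^-1 * s (k0 + j).+1))).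
    by apply: ler_pM => //; exact: ltW (eps_seq_gt0 _).
  rewrite le_eqVlt; apply/orP; left; apply/eqP; field.
  by rewrite !lt0r_neq0 ?s0.
exists (s k0.+1)^-1, (s k0); split; [by rewrite invr_gt0 s0|exact: s0|].
move=> t t0 tk0.
have [K hK] : exists k, s (k0 + k)%N <= t.
  have [k hk] := C_star_exp_large (psi phi t); exists k.
  rewrite -lee_fin -sE ?leq_addr//; apply: psi_inv_le => //.
  by apply: le_trans hk _; apply: C_star_exp_le; exact: leq_addl.
have [j [hj1 hj2]] : exists j, t < s (k0 + j)%N /\ s (k0 + j).+1 <= t.
  elim: K hK => [|K IH] hK; first by move: hK; rewrite addn0; lra.
  have [h|h] := leP (s (k0 + K)%N) t; first exact: IH.
  by exists K; rewrite -addnS.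
exists (k0 + j)%N; split.
  have : C ^- (k0 + j) < psi phi t by apply: psi_inv_lt => //; rewrite sE ?leq_addr.
  by rewrite /psi => /ltW; rewrite ler_pdivlMr.
move=> l l0 lpos hl; apply: le_trans (leng l l0 lpos hl j) _.
by rewrite ler_wpM2l// invr_ge0 ltW// s0.
Qed.

Lemma first_pos_spec (P : set nat) : (exists g, (0 < g)%N /\ P g) ->
  (0 < first_pos P)%N /\ P (first_pos P).
Proof.
move=> [g hg]; rewrite /first_pos.
have ex : exists n, `[< (0 < n)%N /\ P n >] by exists g; apply/asboolP.
case: (ex_minnP ex) => m /asboolP [m0 Pm] hm.
case: xgetP => [x _ [h1 h2 _]|/(_ m) h]; first by split.
by case: h; split=> // k k0 Pk; apply: hm; apply/asboolP.
Qed.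

Lemma gap_spec (Q k : nat) : 1 < min_deriv f -> 0 < K_star B ->
  (0 < gap_seq phi f B Q k)%N /\
  K_star B * min_deriv f ^- gap_seq phi f B Q k <= eps_seq phi B k.
Proof.
move=> D1 K0; set D := min_deriv f in D1 *; have D0 : 0 < D by lra.
have DQ : 1 <= D ^+ Q by rewrite exprn_ege1// ltW.
have [] := @first_pos_spec [set g | K_star B * D ^- g * D ^+ Q <= eps_seq phi B k].
  have c : D^-1 ^+ g @[g --> \oo] --> 0.
    by apply: cvg_expr; rewrite ger0_norm ?invr_ge0 ?(ltW D0)// invf_lt1.
  pose e := eps_seq phi B k / (K_star B * D ^+ Q).
  have e0 : 0 < e by rewrite divr_gt0 ?eps_seq_gt0// mulr_gt0//; lra.
  move/cvgrPdist_lt : c => /(_ _ e0) [g _ hg]; exists g.+1; split=> //=.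
  have := hg g.+1 (leqnSn _); rewrite /= sub0r normrN ger0_norm ?exprn_ge0 ?invr_ge0 ?(ltW D0)//.
  rewrite exprVn /e ltr_pdivlMr; last by rewrite mulr_gt0//; lra.
  by move=> /ltW; congr (_ <= _); ring.
rewrite -/(gap_seq phi f B Q k) => h1 h2; split=> //; apply: le_trans h2.
by rewrite ler_peMr// mulr_ge0 ?(ltW K0)// invr_ge0 exprn_ge0 ?(ltW D0).
Qed.

End scales.

(** * Descent through the arcs *)

(** Locates the block in which a partial sum ends. Monotonicity of [T] is replaced by minimality:
    the least index whose successor value exceeds [m] has its own value at most [m]. *)
Lemma exists_block_index (T : nat -> nat) (m0 m : nat) : (forall k, (k < T k)%N) -> (T m0 <= m)%N ->
  exists k, [/\ (m0 <= k)%N, (T k <= m)%N & (m < T k.+1)%N].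
Proof.
move=> hT; elim: m => [|m IH] hm; first by have := hT m0; lia.
have [h|h] := leqP (T m0) m; last first.
  have e : T m0 = m.+1 by lia.
  have ex : exists k, ((m0 <= k) && (m.+1 < T k.+1))%N.
    by exists (m0 + m)%N; rewrite leq_addr/=; have := hT (m0 + m).+1; lia.
  case: (ex_minnP ex) => k /andP[k1 k2] hk.
  case: (eqVneq k m0) => [kE|kn]; first by exists k; rewrite kE in k1 k2 *; split => //; lia.
  exists k; split=> //; rewrite leqNgt; apply/negP => hlt.
  have := hk k.-1; have -> : k.-1.+1 = k by lia.
  rewrite hlt andbT => H; have : (k <= k.-1)%N by apply: H; lia.
  lia.
have [k [k1 k2 k3]] := IH h.
have [h2|h2] := ltnP m.+1 (T k.+1); first by exists k; split => //; lia.
have ex : exists j, ((k < j) && (m.+1 < T j.+1))%N.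
  by exists (k.+1 + m)%N; rewrite leq_addr/=; have := hT (k.+1 + m).+1; lia.
case: (ex_minnP ex) => j /andP[j1 j2] hj.
exists j; split=> //; first lia.
rewrite leqNgt; apply/negP => hlt.
case: (eqVneq j k.+1) => [jE|jn]; first by rewrite jE in hlt; lia.
have := hj j.-1; have -> : j.-1.+1 = j by lia.
rewrite hlt andbT => H; have : (j <= j.-1)%N by apply: H; lia.
lia.
Qed.

Section path.
Context {R : realType}.
Implicit Types (z xi : R[i]).
(** The pieces are arcs, whose traces are measurable, while [D] may be any set: a sum over disjoint
    pieces only has to stay below the whole for the pigeonhole argument. *)
Definition superadditive_on_arcs (nu : set R[i] -> \bar R) :=
  forall n (I : 'I_n -> set R[i]) D, trivIset setT I ->
    (forall j, exists x y, I j = arc x y) -> (forall j, I j `<=` D) ->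
      (\sum_(j < n) nu (I j) <= nu D)%E.

Variables (f : R[i] -> R[i]) (B : @arc_constants R) (lam : R) (Q : nat).
Hypothesis hB : admissible f B.
Hypothesis f0 : f 0 = 0.
Hypothesis hdyn : forall N zeta l, modulus zeta = 1 -> 0 < l -> l <= 1 ->
      eta_star B <= circle_measure (iter N f @` closed_arc zeta l) ->
      circle_measure (iter N f @` closed_arc zeta l) <= 4 * eta_star B ->
      modulus (iter (N + Q) f (arc_center (d_star B) zeta l)) < eps_star B /\
      forall n xi xi', (n <= N)%N -> closed_arc zeta l xi -> closed_arc zeta l xi' ->
        modulus (iter n f xi - iter n f xi') <= 16 * lam ^- (N - n).
Local Notation d := (d_star B).
Local Notation C := (C_star B).
Local Notation J z := (dilated_arc (d%:R : R) z).

Variables (a : nat -> R[i]) (w : R[i]) (M Nn : nat -> nat).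
Local Notation u n := (modulus (a n)).
Local Notation S m p := (\sum_(m <= n < p) u n).
Hypothesis M0 : M 0 = 1%N.
Hypothesis MNn : forall k, (M k < Nn k)%N.
Hypothesis MS : forall k, M k.+1 = (Nn k + Q)%N.
Hypothesis Q0 : (0 < Q)%N.
Variable eps : nat -> R.
Hypothesis heps : forall k, K_star B * min_deriv f ^- (Nn k - M k) <= eps k.
Variable nu : set R[i] -> \bar R.
Hypothesis nu_super : superadditive_on_arcs nu.

Definition is_arc_len (D : set R[i]) (l : R) := exists x, [/\ 0 <= l, l <= 1 & D = arc x (x + l)].

Lemma is_arc_len_measure D l : is_arc_len D l -> circle_measure D = l.
Proof. by move=> [x [l0 l1 ->]]; rewrite circle_measure_arc ?lerDl ?lerD2l// addrC addKr. Qed.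

Lemma closed_arc_len zeta l : modulus zeta = 1 -> 0 <= l -> l <= 1 ->
  is_arc_len (closed_arc zeta l) l.
Proof.
move=> /expi2pi_surj [s ->] l0 l1; exists (s - l / 2); split=> //.
by rewrite closed_arc_expi2pi; congr (arc _ _); lra.
Qed.

Lemma unit_circle_len : is_arc_len (@unit_circle R) 1.
Proof. by exists 0; rewrite add0r; split => //; rewrite arc_full// add0r. Qed.

Definition remainder (k : nat) xi : R[i] := w - \sum_(1 <= n < M k) a n * iter n f xi.

(* Some point of the arc attached to [z]; [path_extend] aims at [w] from the
   partial sum at this point. *)
Definition rep z : R[i] := xget 1 (J z).
(** The value 1 at a zero remainder keeps the modulus equal to 1 in all cases, so multiplying
    coefficients by it does not change their moduli. *)
Definition dir (k : nat) z : R[i] :=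
  if remainder k (rep z) == 0 then 1 else remainder k (rep z) / (modulus (remainder k (rep z)))%:C%C.

Lemma dirE k z : remainder k (rep z) = (modulus (remainder k (rep z)))%:C%C * dir k z.
Proof.
rewrite /dir; case: eqP => [->|/eqP n0]; first by rewrite modulus0 mul0r.
rewrite mulrC divfK//; have := modulus_gt0 n0; set m := modulus _ => m0.
by apply/eqP => -[h]; rewrite h ltxx in m0.
Qed.

Lemma modulus_dir k z : modulus (dir k z) = 1.
Proof.
rewrite /dir; case: (remainder k (rep z) =P 0) => [_|/eqP n0]; first by rewrite modulus1.
by rewrite modulusM modulusV modulus_real ?modulus_ge0// divff// lt0r_neq0// modulus_gt0.
Qed.

Definition invariant (k : nat) z := [/\ modulus z < 1, modulus (iter (M k) f z) < eps_star B,
  exists l, is_arc_len (J z) l & (nu (J z) < (C ^- k * circle_measure (J z))%:E)%E].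

Definition path_step (k : nat) z z' := [/\ J z' `<=` J z,
  circle_measure (J z') <= eps k * circle_measure (J z),
  forall xi, J z' xi -> c_star B * Num.sqrt (\sum_(M k <= n < (Nn k).+1) u n ^+ 2) <=
     complex.Re ((dir k z)^*%C * \sum_(M k <= n < (Nn k).+1) a n * iter n f xi) &
  forall n xi xi', (n <= Nn k)%N -> J z' xi -> J z' xi' ->
        modulus (iter n f xi - iter n f xi') <= 16 * lam ^- (Nn k - n)].

Lemma path_extend k z : invariant k z -> exists z', invariant k.+1 z' /\ path_step k z z'.
Proof.
case: hB => -[/andP[e0 e1] /andP[c0 c1] /andP[eta0 eta4] K1 d0] hfam.
move=> [z1 hz [l0 hl0] hnu].
have M1 : (0 < M k)%N by case: k {hz hnu} => [|k]; rewrite ?M0// MS; lia.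
have zdisk : unit_disk z by rewrite /unit_disk/= modulus_lt1.
have [n [I [[n0 Itriv Iarc] hre hmass heta hlen]]] :=
  (* Property (1) speaks of real parts. Multiplying the coefficients by the conjugate of [dir k z]
     turns it into a lower bound for the component of the block along the remainder. *)
  hfam (M k) (Nn k) M1 (MNn k) z zdisk hz (fun n => (dir k z)^*%C * a n).
have C0 : 0 < C by rewrite /C_star divr_gt0// mulr_gt0// ltr0n.
have [j hj] : exists j : 'I_n, (nu (I j) < (C ^- k.+1 * circle_measure (I j))%:E)%E.
  apply: contrapT => /forallNP hn.
  have h1 j : ((C ^- k.+1 * circle_measure (I j))%:E <= nu (I j))%E.
    by rewrite leNgt; apply/negP; exact: hn.
  have h2 : (\sum_(j < n) nu (I j) <= nu (J z))%E.
    apply: nu_super => //; last by move=> j; case: (Iarc j).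
    move=> j; have [[zeta [l [hz1 l1 l2 ->]]] _] := Iarc j.
    have [x [_ _ hx]] := closed_arc_len ((modulus_eq1 _).1 hz1) (ltW l1) l2.
    by exists x, (x + l).
  have h3 : (\sum_(j < n) (C ^- k.+1 * circle_measure (I j))%:E <= nu (J z))%E.
    by apply: le_trans h2; apply: lee_sum => j _.
  have := le_lt_trans h3 hnu; rewrite sumEFin lte_fin -mulr_sumr ltNge => /negP; apply.
  apply: (@le_trans _ _ (C ^- k.+1 * (C * circle_measure (J z)))).
    by rewrite mulrA exprSr invfM divfK// lt0r_neq0.
  by rewrite ler_wpM2l// invr_ge0 exprn_ge0// ltW.
have [[zeta [l [hz1 l1 l2 IE]]] Isub] := Iarc j.
have hz2 := (modulus_eq1 _).1 hz1.
have [eta1 eta2] := heta j; rewrite IE in eta1 eta2.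
have [hd1 hd2] := hdyn hz2 l1 l2 eta1 eta2.
have JE := arc_center_dilated d0 hz2 l1 l2.
exists (arc_center d zeta l); split; split.
- exact: arc_center_disk.
- by rewrite MS.
- by exists l; rewrite JE; apply: closed_arc_len => //; exact: ltW.
- by rewrite JE -IE.
- by rewrite JE -IE.
- rewrite JE -IE; apply: le_trans (hlen j) _.
  by rewrite ler_wpM2r ?circle_measure_ge0.
- move=> xi; rewrite JE -IE => hxi; have := hre j xi hxi.
  have -> : \sum_(M k <= i < (Nn k).+1) modulus ((dir k z)^*%C * a i) ^+ 2 = \sum_(M k <= i < (Nn k).+1) u i ^+ 2.
    by apply: eq_bigr => i _; rewrite modulusM modulusJ modulus_dir mul1r.
  by rewrite mulr_sumr; under [X in complex.Re X]eq_bigr do rewrite -mulrA.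
- by rewrite JE.
Qed.

Lemma invariant0 : (nu (@unit_circle R) < 1)%E -> invariant 0 0.
Proof.
move=> nu_circle.
case: hB => -[/andP[e0 e1] _ _ _ d0] _.
have i0 m : iter m f 0 = 0 by elim: m => //= m ->.
have J0 : J 0 = @unit_circle R by rewrite /dilated_arc eqxx.
split; rewrite ?modulus0 ?i0 ?modulus0//.
- by exists 1; rewrite J0; exact: unit_circle_len.
- by rewrite J0 expr0 invr1 mul1r circle_measure_unit_circle.
Qed.

Lemma path_exists : (nu (@unit_circle R) < 1)%E -> exists Z : nat -> R[i],
  (forall k, invariant k (Z k)) /\ (forall k, path_step k (Z k) (Z k.+1)).
Proof.
move=> nu_circle.
have H (kz : nat * R[i]) : exists z', invariant kz.1 kz.2 ->
  invariant kz.1.+1 z' /\ path_step kz.1 kz.2 z'.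
  have [h|h] := pselect (invariant kz.1 kz.2); last by exists 0.
  by have [z' hz'] := path_extend h; exists z'.
have [g hg] := choice H.
pose Z := fix Z k := if k is k'.+1 then g (k', Z k') else 0.
have hZ k : invariant k (Z k).
  elim: k => [|k IH]; first exact: invariant0.
  by have [] := hg (k, Z k) IH.
by exists Z; split => // k; have [] := hg (k, Z k) (hZ k).
Qed.

Variable Z : nat -> R[i].
Hypothesis Zinv : forall k, invariant k (Z k).
Hypothesis Zstep : forall k, path_step k (Z k) (Z k.+1).

Lemma J_arc k : exists x y, x <= y /\ J (Z k) = arc x y.
Proof. by have [_ _ [l [x [l0 l1 ->]]] _] := Zinv k; exists x, (x + l); rewrite lerDl. Qed.

Lemma rep_in k : J (Z k) (rep (Z k)).
Proof.
have [x [y [xy JE]]] := J_arc k.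
have : J (Z k) (expi2pi x) by rewrite JE; exists x => //=; rewrite in_itv/= lexx.
by move=> h; apply: (xgetPex 1); exists (expi2pi x).
Qed.

Lemma J_nested j k : (j <= k)%N -> J (Z k) `<=` J (Z j).
Proof.
elim: k => [|k IH]; first by rewrite leqn0 => /eqP ->.
rewrite leq_eqVlt => /predU1P[->//|jk].
by have [h _ _ _] := Zstep k; apply: subset_trans h (IH jk).
Qed.

Lemma path_point : exists xi, forall k, J (Z k) xi.
Proof.
have cpt k : compact (J (Z k)) by have [x [y [_ ->]]] := J_arc k; exact: arc_compact.
have cl k : closed (J (Z k)) by apply: compact_closed (cpt k); exact: norm_hausdorff.
have [|xi [_ hxi]] := cpt 0%N (rep (Z k) @[k --> \oo]).
  by exists 0%N => // k _; apply: (J_nested (leq0n k)); exact: rep_in.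
exists xi => k; apply: cl => U hU.
have [] := hxi (J (Z k)) U _ hU; last by move=> y hy; exists y.
by exists k => // j /= kj; apply: (J_nested kj); exact: rep_in.
Qed.

Lemma J_circle k xi : J (Z k) xi -> modulus xi = 1.
Proof.
by have [x [y [_ ->]]] := J_arc k => -[t _ <-]; rewrite modulus_expi2pi.
Qed.

Hypothesis lam1 : 1 < lam.
Hypothesis fcirc : forall xi, modulus xi = 1 -> modulus (f xi) = 1.
Variable gam : R.
Hypothesis gam0 : 0 <= gam.
Hypothesis gam1 : gam <= 1.
Hypothesis hgam : forall k, gam * S (M k) (Nn k).+1 <=
  c_star B * Num.sqrt (\sum_(M k <= n < (Nn k).+1) u n ^+ 2).
Variable g : R.
Hypothesis g0 : 0 <= g.
Hypothesis ggam : 2 * g < gam / 2.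
Hypothesis hT : forall k, S (Nn k).+1 (M k.+1) <= g * (S (M k) (Nn k).+1 + S (M k.+1) (Nn k.+1).+1).
Hypothesis Bcvg : S (M k) (Nn k).+1 @[k --> \oo] --> 0.
Hypothesis Bdiv : forall A, exists n, A < \sum_(0 <= k < n) S (M k) (Nn k).+1.
Hypothesis ucvg : (u n) @[n --> \oo] --> 0.

Lemma M_gt k : (k < M k)%N.
Proof. by elim: k => [|k IH]; rewrite ?M0// MS; have := MNn k; lia. Qed.

Lemma iter_circle n xi : modulus xi = 1 -> modulus (iter n f xi) = 1.
Proof. by move=> h; elim: n => //= n; exact: fcirc. Qed.

(** Up to a constant, how much the partial sum before [m] can vary over an arc whose images reach
    unit size near time [m]: the term of index [n] varies by a multiple of [lam ^- (m - n)]. *)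
Definition average (m : nat) : R := \sum_(1 <= n < m) u n * lam ^- (m - n).

Lemma average_ge0 m : 0 <= average m.
Proof.
apply: sumr_ge0 => n _; rewrite mulr_ge0 ?modulus_ge0// invr_ge0 exprn_ge0//.
exact: ltW (lt_trans ltr01 lam1).
Qed.

Lemma average_cvg : average m @[m --> \oo] --> 0.
Proof.
have l0 : 0 < lam := lt_trans ltr01 lam1.
apply: (@geometric_average_cvg0 R lam (fun n => u n)) => //; first exact: average_ge0.
move=> m; rewrite ler_pdivlMr//; case: m => [|m].
  by rewrite /average !big_geq// mul0r add0r modulus_ge0.
rewrite /average big_nat_recr//= mulrDl subSnn expr1 divfK ?lt0r_neq0// lerD2r.
rewrite mulr_suml le_eqVlt; apply/orP; left; apply/eqP.
apply: eq_big_nat => n /andP[_ nm].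
rewrite -mulrA (_ : (m.+2 - n = (m.+1 - n).+1)%N) ?exprSr ?invfM ?divfK ?lt0r_neq0//.
by rewrite subSn// ltnW.
Qed.

Lemma remainder_oscillation k xi : (forall j, J (Z j) xi) ->
  modulus (remainder k xi - remainder k (rep (Z k))) <= 16 * lam ^+ Q * average (M k).
Proof.
move=> hxi; have l0 : 0 < lam := lt_trans ltr01 lam1.
have -> : remainder k xi - remainder k (rep (Z k)) =
    \sum_(1 <= n < M k) a n * (iter n f (rep (Z k)) - iter n f xi).
  have -> : \sum_(1 <= n < M k) a n * (iter n f (rep (Z k)) - iter n f xi) =
      \sum_(1 <= n < M k) a n * iter n f (rep (Z k)) - \sum_(1 <= n < M k) a n * iter n f xi.
    by rewrite -sumrB; apply: eq_bigr => n _; rewrite mulrBr.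
  by rewrite /remainder; ring.
apply: le_trans (modulus_sum _ _ _) _.
case: k => [|k]; first by rewrite /average M0 !big_geq// mulr0.
rewrite /average mulr_sumr big_nat [leRHS]big_nat; apply: ler_sum => n /andP[n1 nM].
rewrite modulusM mulrCA; apply: ler_wpM2l; first exact: modulus_ge0.
have hz := Zstep k; rewrite MS in nM *.
have [h|h] := leqP n (Nn k).
  have [_ _ _ hosc] := hz; apply: le_trans (hosc n _ _ h (rep_in _) (hxi _)) _.
  rewrite (_ : (Nn k + Q - n = Q + (Nn k - n))%N); last by lia.
  rewrite exprD invfM -mulrA ler_wpM2l// mulrA mulfV ?mul1r//.
  by rewrite expf_neq0// lt0r_neq0.
(* Past [Nn k] the arc is no longer controlled and the trivial bound 2 is used. The factor
   [lam ^+ Q] accounts for these fewer than [Q] indices and for the shift from [Nn k] to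
   [M k.+1]. *)
apply: (@le_trans _ _ 2).
  apply: le_trans (modulus_sub_le _ _) _.
  rewrite !iter_circle ?(J_circle (hxi k.+1))// ?(J_circle (rep_in k.+1))//; lra.
have -> : Q = ((Nn k + Q - n) + (Q - (Nn k + Q - n)))%N by lia.
rewrite exprD mulrA mulrAC addnA (_ : (Nn k + (Nn k + Q - n) + (Q - (Nn k + Q - n)) - n = (Nn k + Q - n))%N); last by lia.
rewrite -(mulrA 16) mulfV ?expf_neq0 ?lt0r_neq0// mulr1.
have : 1 <= lam ^+ (Q - (Nn k + Q - n)) by rewrite exprn_ege1// ltW.
lra.
Qed.

Definition block k xi := \sum_(M k <= n < (Nn k).+1) a n * iter n f xi.

Lemma block_le k xi : modulus xi = 1 -> modulus (block k xi) <= S (M k) (Nn k).+1.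
Proof.
move=> h; apply: le_trans (modulus_sum _ _ _) _; apply: ler_sum => n _.
by rewrite modulusM iter_circle// mulr1.
Qed.

Lemma remainderS k xi : modulus xi = 1 ->
  modulus (remainder k.+1 xi) <= modulus (remainder k xi - block k xi)
     + g * (S (M k) (Nn k).+1 + S (M k.+1) (Nn k.+1).+1).
Proof.
move=> h; have M1 : (1 <= M k)%N by have := M_gt k; lia.
have e : remainder k.+1 xi = (remainder k xi - block k xi) - \sum_((Nn k).+1 <= n < M k.+1) a n * iter n f xi.
  rewrite /remainder /block (big_cat_nat (n := M k) (p := M k.+1))//=; last by rewrite MS;
    have := MNn k; lia.
  rewrite (big_cat_nat (n := (Nn k).+1) (p := M k.+1))//=; [|by have := MNn k;
    lia|by rewrite MS; lia].
  by rewrite addrA !opprD !addrA.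
rewrite e; apply: le_trans (modulus_sub_le _ _) _; rewrite lerD2l.
apply: le_trans (hT k); apply: le_trans (modulus_sum _ _ _) _; apply: ler_sum => n _.
by rewrite modulusM iter_circle// mulr1.
Qed.

(** While the remainder stays above [e], both the oscillation and the block sum are eventually small
    compared with [gam * e], so [steering_step] provides the drift; elsewhere the triangle
    inequality is enough for [drift_cvg0]. *)
Lemma remainder_cvg xi : (forall j, J (Z j) xi) -> modulus (remainder k xi) @[k --> \oo] --> 0.
Proof.
move=> hxi; have h := J_circle (hxi 0%N).
apply: (@drift_cvg0 R _ (fun k => S (M k) (Nn k).+1) (gam / 2) g) => //.
- by move=> k; exact: modulus_ge0.
- by move=> k; apply: sum_ge0 => n; exact: modulus_ge0.
- move=> e e0.
  pose osc k := 16 * lam ^+ Q * average (M k).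
  have osc_cvg : 4 * osc k + S (M k) (Nn k).+1 @[k --> \oo] --> 0.
    have av : average (M k) @[k --> \oo] --> 0.
      apply: (@cvg_comp _ _ _ M average _ \oo _ _ average_cvg).
      apply/cvgnyPge => A; exists A => // k /= Ak; have := M_gt k; lia.
    rewrite -[X in _ --> X](addr0 (0 : R)); apply: cvgD => //.
    by rewrite -(mulr0 (4 : R)); apply: cvgMr; rewrite -(mulr0 (16 * lam ^+ Q)); apply: cvgMr.
  have [ge0|ge0] := leP (gam * e) 0.
    have : 0 < gam by have := g0; have := ggam; lra.
    by move=> gp; have := mulr_gt0 gp e0; lra.
  move/cvgrPdist_lt : osc_cvg => /(_ _ ge0) [k0 _ hk]; exists k0 => // k /= kk0 hd.
  apply: le_trans (remainderS k h) _; rewrite lerD2r.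
  have [_ _ hre _] := Zstep k.
  apply: (@steering_step R _ (remainder k (rep (Z k))) _ (dir k (Z k)) (osc k) _ _ e) => //.
  + exact: remainder_oscillation.
  + exact: block_le.
  + exact: dirE.
  + by apply: le_trans (hgam k) _; exact: hre.
  + by have := hk k kk0; rewrite /= sub0r normrN => /ltW; apply: le_trans; exact: ler_norm.
- move=> k; apply: le_trans (remainderS k h) _; rewrite lerD2r.
  by apply: le_trans (modulus_sub_le _ _) _; rewrite lerD2l block_le.
Qed.

Lemma path_point_sum xi : (forall j, J (Z j) xi) -> sum_level_set f a w xi.
Proof.
move=> hxi; have h := J_circle (hxi 0%N).
split; first by rewrite /unit_circle/= modulus_eq1.
apply/cvg_modulusP => e e0.
(* Bounds the terms from [M k] up to any index before [M k.+1]: a full block and the gap after it.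
   Convergence along the block starts thus extends to all partial sums. *)
pose T k := S (M k) (Nn k).+1 + g * (S (M k) (Nn k).+1 + S (M k.+1) (Nn k.+1).+1).
have Tc : modulus (remainder k xi) + T k @[k --> \oo] --> 0.
  rewrite -[X in _ --> X](addr0 (0 : R)); apply: cvgD; first exact: remainder_cvg.
  rewrite -[X in _ --> X](addr0 (0 : R)); apply: cvgD; first exact: Bcvg.
  have H : g * (S (M k) (Nn k).+1 + S (M k.+1) (Nn k.+1).+1) @[k --> \oo] --> g * (0 + 0).
    apply: cvgMr; apply: cvgD; first exact: Bcvg.
    by have := Bcvg; rewrite -(cvg_shiftS (fun k => S (M k) (Nn k).+1)).
  by rewrite addr0 mulr0 in H.
move/cvgrPdist_lt : Tc => /(_ _ e0) [k0 _ hk0].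
exists (M k0) => // m /= hm.
have [k [k1 k2 k3]] := exists_block_index M_gt hm.
have := hk0 k k1; rewrite /= sub0r normrN => hlt.
apply: le_lt_trans (le_lt_trans (ler_norm _) hlt).
have M1 : (1 <= M k)%N by have := M_gt k; lia.
have -> : \sum_(1 <= n < m) a n * iter n f xi - w = \sum_(M k <= n < m) a n * iter n f xi - remainder k xi.
  by rewrite /remainder (big_cat_nat (n := M k) (p := m))//=; ring.
apply: le_trans (modulus_sub_le _ _) _; rewrite addrC lerD2l.
apply: (@le_trans _ _ (S (M k) m)).
  apply: le_trans (modulus_sum _ _ _) _; apply: ler_sum => n _.
  by rewrite modulusM iter_circle// mulr1.
apply: (@le_trans _ _ (S (M k) (M k.+1))).
  by apply: le_sum_sub => //; [move=> n; exact: modulus_ge0|exact: ltnW].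
rewrite (big_cat_nat (n := (Nn k).+1))//=; [|by have := MNn k; lia|by rewrite MS; lia].
by rewrite lerD2l.
Qed.

End path.

(** * Lower bound for the Hausdorff content *)

Section hausdorff_lower_bound.
Context {R : realType}.
Local Notation e := (@expi2pi R).
Variables (phi : R -> R) (E : set R[i]) (A t0 C : R) (P : nat -> R -> Prop).
Hypothesis hphi : measure_function phi.
Hypothesis A0 : 0 <= A.
Hypothesis t00 : 0 < t0.
Hypothesis C0 : 0 < C.
Hypothesis hscale : forall t, 0 < t -> t < t0 -> exists k, C ^- k * t <= phi t /\ P k t.

(** The point may depend on [nu], hence on the cover to be refuted. [P k t] keeps the link between
    scales and lengths abstract: it stands for what makes arcs of generation [k] at most [A * t]
    long. *)
Hypothesis hpath : forall nu, superadditive_on_arcs nu -> (nu (@unit_circle R) < 1)%E ->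
  exists (xi : R[i]) (J : nat -> set R[i]) (l : nat -> R),
    E xi /\ forall k, [/\ is_arc_len (J k) (l k), J k xi, (nu (J k) < (C ^- k * l k)%:E)%E &
      forall t, P k t -> l k <= A * t].

Lemma arc_trace_measurable (x y x' y' : R) :
  measurable (`[0, 1[ `&` e @^-1` (arc x y `&` arc x' y') : set R).
Proof.
rewrite preimage_setI setIIr; apply: measurableI; exact: arc_measurable.
Qed.

Lemma circle_mu_superadditive n (I : 'I_n -> set R[i]) D (x y : R) : trivIset setT I ->
  (forall j, exists x y, I j = arc x y) -> (forall j, I j `<=` D) ->
  (\sum_(j < n) circle_mu (I j `&` arc x y) <= circle_mu (D `&` arc x y))%E.
Proof.
move=> tI hI sI; rewrite /circle_mu.
pose G (j : 'I_n) : set R := `[0, 1[ `&` e @^-1` (I j `&` arc x y).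
have mG j : measurable (G j) by have [x' [y' h]] := hI j; rewrite /G h; exact: arc_trace_measurable.
have tG : trivIset setT G.
  apply/trivIsetP => i j _ _ ij; apply/seteqP; split => // s [[_ [h1 _]] [_ [h2 _]]].
  by have /trivIsetP /(_ i j Logic.I Logic.I ij) h := tI; have : (I i `&` I j) (e s) by [];
    rewrite h.
have mU : measurable (\big[setU/set0]_(j < n) G j) by apply: bigsetU_measurable => j _; exact: mG.
have <- := measure_semi_additive_ord lebesgue_measure mG tG mU.
apply: le_lebesgue_measure; elim/big_ind: _ => //; first by move=> X Y hX hY s [/hX|/hY].
by move=> j _ s [s0 [h1 h2]]; split=> //; split => //; exact: sI h1.
Qed.

(** Covering arcs may be degenerate or empty, but a scale is only attached to a positive length.
    Right continuity of [phi] permits a slightly larger length at small cost. *)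
Lemma scale_enlarge (m d eps : R) : 0 <= m -> m < d -> 0 < eps ->
  exists t, [/\ m < t, t < d & phi t <= phi m + eps].
Proof.
case: hphi => _ _ _ hr m0 md eps0.
have /cvgrPdist_lt /(_ _ eps0) H := hr m m0.
near (m^'+) => t.
exists t; split; [by near: t; exact: nbhs_right_gt|by near: t; exact: nbhs_right_lt|].
have : `|phi m - phi t| < eps by near: t.
rewrite ltr_norml => /andP[]; lra.
Unshelve. all: by end_near. Qed.

(** The two lifts of [xi] differ by an integer; translating [D] by it brings both arcs to the same
    stretch of the line. *)
Lemma near_arc (D : set R[i]) (l x y r : R) (xi : R[i]) : is_arc_len D l -> D xi -> arc x y xi ->
  l <= r -> D `<=` arc (x - r) (y + r).
Proof.
move=> [a [l0 l1 ->]] [t /= + <-] [s /= + es] lr; rewrite !in_itv/= => /andP[t1 t2] /andP[s1 s2].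
have [k hk] := expi2pi_eq es.
rewrite -(arc_shift a (a + l) k) => _ [v /= + <-]; rewrite in_itv/= => /andP[v1 v2].
by exists v => //=; rewrite in_itv/=; apply/andP; split; lra.
Qed.

Lemma content_lower_bound (dl : R) : dl <= t0 -> dl <= 1 ->
  ((4 * (1 + 2 * A))^-1%:E <= hausdorff_content phi dl E)%E.
Proof.
(* The cover and the enlarged lengths [t n] contribute [kap] each, so the sum of [phi (t n)] is at
   most [2 * kap]. As [En n] is at most [(1 + 2 * A) * t n] long, [nu] has total mass at most
   1/2. *)
move=> dt d1; set kap := _^-1.
have kap0 : 0 < kap by rewrite invr_gt0 mulr_gt0//; have := A0; lra.
rewrite leNgt; apply/negP => /ereal_inf_lt [_ [J [Jarc Jd Jcov] <-]] hsum.
have ph0 n : (0 <= (phi (circle_measure (J n)))%:E)%E.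
  by rewrite lee_fin; case: hphi => _ h _ _; apply: h; exact: circle_measure_ge0.
have /choice [t ht] : forall n, exists t, [/\ circle_measure (J n) < t, t < dl &
    phi t <= phi (circle_measure (J n)) + kap / (2 ^ n.+1)%:R].
  by move=> n; apply: scale_enlarge; rewrite ?circle_measure_ge0// divr_gt0// ltr0n expn_gt0.
have tpos n : 0 < t n by have [h _ _] := ht n; apply: le_lt_trans h; exact: circle_measure_ge0.
have phit : (\sum_(0 <= n <oo) (phi (t n))%:E <= (2 * kap)%:E)%E.
  apply: (@le_trans _ _ (\sum_(0 <= n <oo) ((phi (circle_measure (J n)))%:E + (kap / (2 ^ n.+1)%:R)%:E))%E).
    apply: lee_nneseries => [n _ _|n _]; last by rewrite -EFinD lee_fin; case: (ht n).
    by rewrite lee_fin; case: hphi => _ h _ _; apply: h; exact: ltW.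
  apply: le_trans (epsilon_trick xpredT ph0 (ltW kap0)) _.
  have -> : (2 * kap)%:E = (kap%:E + kap%:E)%E by rewrite -EFinD; congr (_%:E); ring.
  by rewrite leeD2r// ltW.
have /choice [x hx] : forall n, exists xy : R * R, [/\ xy.1 <= xy.2,
  xy.2 - xy.1 < t n & J n `<=` arc xy.1 xy.2].
  move=> n; have [h1 h2 _] := ht n.
  have [x [y [h3 h4 h5]]] := is_arc_cover (Jarc n) h1 (le_trans (ltW h2) d1).
  by exists (x, y).
have /choice [k hk] : forall n, exists k, C ^- k * t n <= phi (t n) /\ P k (t n).
  by move=> n; have [h1 h2 _] := ht n; apply: hscale => //; exact: lt_le_trans dt.
pose En n := arc ((x n).1 - A * t n) ((x n).2 + A * t n).
pose nu S : \bar R := (\sum_(0 <= n <oo) ((C ^- k n)%:E * circle_mu (S `&` En n)))%E.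
have Ck n : 0 <= C ^- k n by rewrite invr_ge0 exprn_ge0// ltW.
have term0 S n : (0 <= (C ^- k n)%:E * circle_mu (S `&` En n))%E.
  by rewrite mule_ge0 ?lee_fin ?circle_mu_ge0.
have nu_super : superadditive_on_arcs nu.
  move=> n I D tI hI sI; rewrite /nu -nneseries_sum//.
  apply: lee_nneseries => [i _ _|i _]; first exact: sume_ge0.
  rewrite -ge0_sume_distrr; last by move=> j _; exact: circle_mu_ge0.
  by apply: lee_wpmul2l; [rewrite lee_fin|exact: circle_mu_superadditive].
have nu_circle : (nu (@unit_circle R) < 1)%E.
  apply: (@le_lt_trans _ _ ((1 + 2 * A)%:E * \sum_(0 <= n <oo) (phi (t n))%:E)%E).
    rewrite -nneseriesZl; last first.
      by move=> n _; rewrite lee_fin; case: hphi => _ h _ _; apply: h; exact: ltW.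
    apply: lee_nneseries => [n _ _|n _]; first exact: term0.
    rewrite circle_muE -!EFinM lee_fin.
    have [hx1 hx2 _] := hx n; have [hk1 _] := hk n.
    have m1 : circle_measure (@unit_circle R `&` En n) <= (1 + 2 * A) * t n.
      apply: le_trans (le_circle_measure (@subIsetr _ _ _)) _.
      have At : 0 <= A * t n by rewrite mulr_ge0// ltW.
      by apply: le_trans (circle_measure_arc_le _) _; lra.
    apply: (@le_trans _ _ (C ^- k n * ((1 + 2 * A) * t n))); first by rewrite ler_wpM2l.
    by rewrite mulrCA ler_wpM2l//; have := A0; lra.
  apply: (@le_lt_trans _ _ ((1 + 2 * A)%:E * (2 * kap)%:E)%E).
    by apply: lee_wpmul2l => //; rewrite lee_fin; have := A0; lra.
  rewrite -EFinM lte_fin (_ : (1 + 2 * A) * (2 * kap) = 2^-1); first lra.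
  by rewrite /kap; field; have := A0; lra.
have [xi [L [l [Exi hL]]]] := hpath nu_super nu_circle.
have [n _ Jxi] := Jcov _ Exi.
have [hx1 hx2 hx3] := hx n; have [hk1 hk2] := hk n.
have [hL1 hL2 hL3 hL4] := hL (k n).
have sub := near_arc hL1 hL2 (hx3 _ Jxi) (hL4 _ hk2).
have : ((C ^- k n * l (k n))%:E <= nu (L (k n)))%E.
  apply: (@le_trans _ _ ((C ^- k n)%:E * circle_mu (L (k n) `&` En n))%E).
    by rewrite (setIidl sub) circle_muE (is_arc_len_measure hL1) EFinM.
  apply: le_trans (nneseries_lim_ge n.+1 _); last by move=> i _ _; exact: term0.
  by rewrite big_nat_recr//= leeDr// sume_ge0.
by rewrite leNgt hL3.
Qed.

Lemma hausdorff_measure_gt0 : (0 < hausdorff_measure phi E)%E.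
Proof.
have k0 : 0 < (4 * (1 + 2 * A))^-1 by rewrite invr_gt0 mulr_gt0//; have := A0; lra.
apply: (@lt_le_trans _ _ ((4 * (1 + 2 * A))^-1)%:E); first by rewrite lte_fin.
rewrite /hausdorff_measure; apply: lime_ge.
  apply: nonincreasing_at_right_is_cvge; near=> z => s r _ _ sr.
  apply: le_ereal_inf => _ [J [h1 h2 h3] <-]; exists J => //; split=> //.
  by move=> n; apply: lt_le_trans sr.
near=> dl; apply: content_lower_bound.
- by near: dl; exact: nbhs_right_le.
- by near: dl; exact: nbhs_right_le.
Unshelve. all: by end_near. Qed.

End hausdorff_lower_bound.

(** * The numerical conditions and the assembly of the proof *)

Section rate.
Context {R : realType}.

Lemma series_unbounded (u : nat -> R) : (forall n, 0 <= u n) ->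
  (\sum_(1 <= n <oo) (u n)%:E)%E = +oo%E -> forall A, exists m, A < \sum_(1 <= n < m) u n.
Proof.
move=> u0 hu A; apply: contrapT => /forallNP hn.
have : (\sum_(1 <= n <oo) (u n)%:E <= A%:E)%E.
  apply: lime_le; first by apply: is_cvg_nneseries => n _ _; rewrite lee_fin.
  by apply: nearW => m; rewrite sumEFin lee_fin leNgt; apply/negP; exact: hn.
by rewrite hu leye_eq.
Qed.

(** The conclusion reads [2 * g < gam / 2] for the cost [g] of the gaps and the drift rate [gam].
    The two hypotheses match the two possible values of the minimum in [mu_rate]. *)
Lemma rate_bound (c beta : R) (N Q : nat) : 0 < c -> 0 < beta -> (2 <= N)%N ->
  0 < c * beta / (2 * Num.sqrt 3) * (1 + 2 / (N%:R - 1))^-1 - 2 / (N%:R - 1) ->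
  0 < c / (2 * Num.sqrt (3 * (N%:R * Q%:R + 1))) * (1 + 2 / (N%:R - 1))^-1 - 2 / (N%:R - 1) ->
  2 * (N%:R - 1)^-1 < c * (mu_rate N Q beta / Num.sqrt 3) / 2.
Proof.
move=> c0 b0 N2 h1 h2.
have N1 : 1 <= N%:R - 1 :> R by have : 2 <= N%:R :> R; [rewrite (ler_nat _ 2)|lra].
have fac (x : R) : 0 <= x -> x * (1 + 2 / (N%:R - 1))^-1 <= x.
  move=> x0; rewrite ler_piMr// invf_le1; last by rewrite ltr_wpDr// divr_ge0//; lra.
  by rewrite lerDl divr_ge0//; lra.
have s3 : 0 < Num.sqrt (3 : R) by rewrite sqrtr_gt0.
have K0 : 0 < N%:R * Q%:R + 1 :> R by rewrite ltr_wpDl// mulr_ge0.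
have sK : 0 < Num.sqrt (N%:R * Q%:R + 1 : R) by rewrite sqrtr_gt0.
rewrite /mu_rate; case: (leP beta _) => _.
  apply: (@lt_le_trans _ _ (c * beta / (2 * Num.sqrt 3))).
    rewrite -subr_gt0; apply: lt_le_trans h1 _; rewrite lerD2r fac//.
    by rewrite divr_ge0 ?mulr_ge0 ?ltW.
  by rewrite le_eqVlt; apply/orP; left; apply/eqP; field; rewrite lt0r_neq0.
apply: (@lt_le_trans _ _ (c / (2 * Num.sqrt (3 * (N%:R * Q%:R + 1))))).
  rewrite -subr_gt0; apply: lt_le_trans h2 _; rewrite lerD2r fac//.
  by rewrite divr_ge0 ?mulr_ge0 ?sqrtr_ge0 ?ltW.
rewrite sqrtrM// le_eqVlt; apply/orP; left; apply/eqP; field.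
by rewrite !lt0r_neq0.
Qed.

End rate.

Theorem theorem2 (R : realType) (f : R[i] -> R[i]) (B : @arc_constants R)
    (hf : is_blaschke0 f) (hrot : ~ is_rotation f) (hB : admissible f B) :
  exists (c : R) (Q : nat), [/\ 0 < c, c < 1, (0 < Q)%N &
  forall (a : nat -> R[i]) (phi : R -> R),
    a n @[n --> \oo] --> (0 : R[i]) ->
    (\sum_(1 <= n <oo) (modulus (a n))%:E)%E = +oo%E ->
    measure_function phi ->
    (forall s t : R, 0 < s -> s <= t -> psi phi t <= psi phi s) ->
    psi phi t @[t --> 0^'+] --> +oo ->
  forall (beta : R) (N : nat),
    0 < beta -> beta < 1 -> (2 <= N)%N ->
    0 < c * beta / (2 * Num.sqrt 3) * (1 + 2 / (N%:R - 1))^-1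
        - 2 / (N%:R - 1) ->
    0 < c / (2 * Num.sqrt (3 * (N%:R * Q%:R + 1)))
          * (1 + 2 / (N%:R - 1))^-1
        - 2 / (N%:R - 1) ->
    \sum_(M_bar phi f B Q N k <= n < N_bar phi f B Q N k) modulus (a n)
      @[k --> \oo] --> (0 : R) ->
    (forall k : nat, (1 <= k)%N ->
      beta * \sum_(M_bar phi f B Q N k <= n < N_bar phi f B Q N k)
               modulus (a n)
        <= Num.sqrt (\sum_(M_bar phi f B Q N k <= n < N_bar phi f B Q N k)
                       modulus (a n) ^+ 2)) ->
  forall w : R[i],
    (0 < hausdorff_measure phi (sum_level_set f a w))%E].
Proof.
have [[/andP[e0 e1] /andP[c0 c1] /andP[eta0 eta4] K1 d0] _] := hB.
have [lam [Q [lam1 Q0 D1 [f0 fcirc] hdyn]]] := blaschke_dynamics hf hrot d0 eta0 eta4 e0.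
exists (c_star B), Q; split=> // a phi acvg adiv hphi hdec hinf beta N b0 b1 N2 h1 h2 hL hbeta w.
have K0 : 0 < K_star B by lra.
have dR : 1 <= (d_star B)%:R :> R by rewrite (ler_nat _ 1).
have C0 : 0 < C_star B by rewrite /C_star divr_gt0//; lra.
have C1 : C_star B < 1 by rewrite /C_star ltr_pdivrMr; lra.
pose u n := modulus (a n).
have u0 n : 0 <= u n by exact: modulus_ge0.
have ucvg : u n @[n --> \oo] --> 0.
  by move/cvg_modulus0 : acvg; under eq_fun do rewrite subr0.
have udiv := series_unbounded u0 adiv.
(* The given sequences start at index 1 and the generations at 0, hence the shift, which reappears
   in [eps_seq phi B k.+1]. *)
pose Mb k := M_bar phi f B Q N k.+1; pose Nb k := N_bar phi f B Q N k.+1.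
have gap k := gap_spec hinf C0 C1 Q k D1 K0.
have MNb k : (Mb k < Nb k)%N by rewrite /Mb /Nb /N_bar -[X in (X < _)%N]addn0 ltn_add2l;
  case: (gap k.+1).
have MbS k : Mb k.+1 = (Nb k + N * Q)%N by [].
have Lcvg : \sum_(Mb k <= n < Nb k) u n @[k --> \oo] --> 0.
  by move: hL;
    rewrite -(cvg_shiftS (fun k => \sum_(M_bar phi f B Q N k <= n < N_bar phi f B Q N k) modulus (a n))).
have hb k : beta * \sum_(Mb k <= n < Nb k) u n <= Num.sqrt (\sum_(Mb k <= n < Nb k) u n ^+ 2) by exact: hbeta.
have [M [Nn [[M0 MNn MS hM] [hT Bcvg Bdiv hrate]]]] :=
  schedule u0 N2 Q0 (erefl : Mb 0 = 1%N) MbS MNb ucvg Lcvg udiv b0 hb.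
have N1 : 1 <= N%:R - 1 :> R by have : 2 <= N%:R :> R; [rewrite (ler_nat _ 2)|lra].
set mu := mu_rate N Q beta in hrate.
have mu0 : 0 < mu by exact: mu_rate_gt0.
have s3 : 1 <= Num.sqrt (3 : R) by rewrite -[leLHS]sqrtr1 ler_sqrt//; lra.
have rate0 : 0 <= mu / Num.sqrt 3 by rewrite divr_ge0 ?ltW//; lra.
have rate1 : mu / Num.sqrt 3 <= 1.
  rewrite ler_pdivrMr ?mul1r; last lra.
  apply: le_trans s3; apply: le_trans (ltW b1); by rewrite /mu /mu_rate ge_min lexx.
(* The block from [M k] to [Nn k] is at least as long as the prescribed gap, and [min_deriv f]
   exceeds 1, so its factor is no larger. *)
have heps k : K_star B * min_deriv f ^- (Nn k - M k) <= eps_seq phi B k.+1.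
  have [_ h] := gap k.+1; apply: le_trans h; rewrite ler_wpM2l ?(ltW K0)//.
  have D0 : 0 < min_deriv f by exact: lt_trans ltr01 D1.
  rewrite lef_pV2 ?posrE ?exprn_gt0//; apply: ler_weXn2l; first exact: ltW.
  by have [m1 m2] := hM k; apply: leq_trans (leq_sub m2 m1); rewrite /Nb /Mb /N_bar addKn.
have [A [t0 [A0 t00 hscale]]] := arc_length_scale hdec hinf C0 C1.
apply: (hausdorff_measure_gt0 hphi (ltW A0) t00 C0 hscale).
move=> nu nu_super nu_circle.
have [Z [Zinv Zstep]] := path_exists hB f0 hdyn a w M0 MNn MS Q0 heps nu_super nu_circle.
have [xi hxi] := path_point Zinv Zstep.
pose J k := dilated_arc (d_star B)%:R (Z k).
have len k : is_arc_len (J k) (circle_measure (J k)).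
  by have [_ _ [l hl] _] := Zinv k; rewrite (is_arc_len_measure hl).
have gam0 : 0 <= c_star B * (mu / Num.sqrt 3) by rewrite mulr_ge0// ltW.
have gam1 : c_star B * (mu / Num.sqrt 3) <= 1 by rewrite mulr_ile1// ltW.
have hgam k : c_star B * (mu / Num.sqrt 3) * \sum_(M k <= n < (Nn k).+1) u n <=
    c_star B * Num.sqrt (\sum_(M k <= n < (Nn k).+1) u n ^+ 2).
  by rewrite -mulrA ler_wpM2l ?(ltW c0)//; exact: hrate.
have g0 : 0 <= (N%:R - 1)^-1 :> R by rewrite invr_ge0; lra.
have ggam := rate_bound c0 b0 N2 h1 h2.
have hT' k : \sum_((Nn k).+1 <= n < M k.+1) u n <= (N%:R - 1)^-1 *
    (\sum_(M k <= n < (Nn k).+1) u n + \sum_(M k.+1 <= n < (Nn k.+1).+1) u n).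
  by rewrite mulrC ler_pdivlMr 1?mulrC; [exact: hT|lra].
exists xi, J, (fun k => circle_measure (J k)); split.
  exact: (path_point_sum M0 MNn MS Q0 Zinv Zstep lam1 fcirc gam0 gam1 hgam g0 ggam hT' Bcvg Bdiv ucvg).
move=> k; split; [exact: len|exact: hxi|by have [_ _ _ h] := Zinv k|].
(* The predicate [P] furnished by [arc_length_scale] quantifies over all admissible length
   sequences; it is applied to the lengths along this descent. *)
move=> t /(_ (fun j => circle_measure (J j))); apply.
- exact: circle_measure_le1.
- by move=> j; exact: circle_measure_ge0.
- by move=> j; have [_ h _ _] := Zstep j.
Qed.
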